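(* Let $q$ be a prime power and let $C\subseteq\mathbb{F}_{q^2}^n$ be a Hermitian self-orthogonal linear code (respectively, $C\subseteq\mathbb{F}_q^n$ a Euclidean self-orthogonal linear code), with associated stabilizer code $Q(C)\subseteq\mathbb{C}^{q^n}$. Then $Q(C)$ is a quantum $(r,\delta)$-LRC if and only if for every index $i\in\{1,\dots,n\}$ there exists a set $J\subseteq\{1,\dots,n\}$ with $i\in J$ and $|J|\leq r+\delta-1$ such that, for every subset $I\subsetneq J$ with $|I|=\delta-1$, \[\sigma_I\left[\pi_J\left(C^{\perp_h}\right)\right]=\sigma_I(C)\qquad\left(\text{respectively, } \sigma_I\left[\pi_J\left(C^{\perp_e}\right)\right]=\sigma_I(C)\right).\]
   Context: $q$ is a power of a prime $p$; $r\ge1$, $\delta\ge2$ integers. Hermitian product on $\mathbb F_{q^2}^n$: $\mathbf x\cdot_h\mathbf y=\sum_jx_jy_j^q$; $C^{\perp_h}$ Hermitian dual; Hermitian self-orthogonal means $C\subseteq C^{\perp_h}$; $C^{\perp_e}$ Euclidean dual, Euclidean self-orthogonal means $C\subseteq C^{\perp_e}$. For $D\subseteq\mathbb F^n$ and $R\subseteq\{1,\dots,n\}$: $\pi_R(D)=\{(c_j)_{j\in R}:\mathbf c\in D\}$, $\sigma_R(D)=\{(c_j)_{j\in R}:\mathbf c\in D,\ \mathrm{supp}(\mathbf c)\subseteq R\}$; shortening at $I$ of a code with coordinates indexed by $J\supseteq I$ is defined likewise. Stabilizer codes: for $\mathbb F_q$-linear $D\subseteq\mathbb F_q^{2n}$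 self-orthogonal for $(\mathbf a|\mathbf b)\cdot_s(\mathbf c|\mathbf d)=\mathbf a\cdot\mathbf d-\mathbf b\cdot\mathbf c$, with $\xi=e^{2\pi\iota/p}$, $X(a)|x\rangle=|x+a\rangle$, $Z(b)|x\rangle=\xi^{\mathrm{tr}_{q/p}(bx)}|x\rangle$, $E_{(\mathbf a,\mathbf b)}=\bigotimes_jX(a_j)Z(b_j)$, $Q(D)$ is the common eigenspace $\{v:Ev=\lambda(E)v\ \forall E\in S\}$, $S$ generated by scalars $\xi^\ell\mathcal I$ and $E_{\mathbf y}$, $\mathbf y\in D$, $\lambda$ a character with $\lambda(\xi\mathcal I)=\xi$. In the Hermitian case $Q(C)$ is the stabilizer code associated with $C$ via a normal basis $\{\varsigma,\varsigma^q\}$ of $\mathbb F_{q^2}/\mathbb F_q$ and $\psi(\mathbf a|\mathbf b)=\varsigma\mathbf a+\varsigma^q\mathbf b$ (defined by $\psi^{-1}(C)$); in the Euclidean case $Q(C)=Q(C\times C)$ (CSS). Let $\Gamma(\rho)=q^{-2}\sum_{a,b}X(a)Z(b)\rho(X(a)Z(b))^\dagger$, $\Gamma^I$ apply $\Gamma$ on qudits in $I$, identity elsewhere. For $\emptyset\ne I\subsetneq J$, $Q$ is $(I,J)$-locally recoverable if there is a trace-preserving quantum operation $\mathcal R$ acting only on qudits in $J$ with $\mathcal R\circ\Gamma^I(|\varphi\rangle\langle\varphi|)=|\varphi\rangle\langle\varphi|$ for all $|\varphi\rangle\in Q$. $Q$ is a quantum $(r,\delta)$-LRC if for each $i$ there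 is $J\ni i$ with $|J|\le r+\delta-1$ such that $Q$ is $(I,J)$-locally recoverable for every $I\subsetneq J$ with $|I|=\delta-1$. *)

(* Defs.v *)
From HB Require Import structures.
From mathcomp Require Import all_boot all_order all_algebra.
From mathcomp Require Import complex.
From mathcomp Require Import reals Rstruct.
From Stdlib Require Import Raxioms Rtrigo_def Rtrigo1.

Set Implicit Arguments.
Unset Strict Implicit.
Unset Printing Implicit Defensive.
Import Order.TTheory GRing.Theory Num.Theory.
Local Open Scope ring_scope.

Notation CC := (Rdefinitions.R)[i].

Definition xi (p : nat) : CC :=
  Complex (cos (2 * PI / INR p)%R) (sin (2 * PI / INR p)%R).

Definition supp (K : fieldType) (n : nat) (x : 'rV[K]_n) : {set 'I_n} :=
  [set k | x 0 k != 0].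

(* restriction to coordinates in R (coordinates outside R are set to 0;
   this zero-padded vector represents the vector (x_j)_{j in R}) *)
Definition restr (K : fieldType) (n : nat) (R : {set 'I_n}) (x : 'rV[K]_n) : 'rV[K]_n :=
  \row_k (if k \in R then x 0 k else 0).

Definition punct (K : finFieldType) (n : nat) (R : {set 'I_n}) (D : {set 'rV[K]_n}) :
  {set 'rV[K]_n} := [set restr R c | c in D].
Definition shorten (K : finFieldType) (n : nat) (R : {set 'I_n}) (D : {set 'rV[K]_n}) :
  {set 'rV[K]_n} := [set restr R c | c in [set c in D | supp c \subset R]].

Definition lincode (K : finFieldType) (n : nat) (C : {set 'rV[K]_n}) : Prop :=
  0 \in C /\ (forall (c : K) x y, x \in C -> y \in C -> c *: x + y \in C).

Definition herm (K : finFieldType) (q n : nat) (x y : 'rV[K]_n) : K :=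
  \sum_(j < n) x 0 j * (y 0 j) ^+ q.
Definition hdual (K : finFieldType) (q n : nat) (C : {set 'rV[K]_n}) : {set 'rV[K]_n} :=
  [set y | [forall x in C, herm q x y == 0]].

Definition eucl (K : finFieldType) (n : nat) (x y : 'rV[K]_n) : K :=
  \sum_(j < n) x 0 j * y 0 j.
Definition edual (K : finFieldType) (n : nat) (C : {set 'rV[K]_n}) : {set 'rV[K]_n} :=
  [set y | [forall x in C, eucl x y == 0]].

Definition LRC_cond (K : finFieldType) (n : nat) (C Cd : {set 'rV[K]_n}) (r delta : nat) : Prop :=
  forall i : 'I_n, exists J : {set 'I_n},
    [/\ i \in J, leq #|J| (subn (addn r delta) 1) &
      forall I : {set 'I_n}, I \proper J -> #|I| = subn delta 1 ->
        shorten I (punct J Cd) = shorten I C].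

(* Hilbert space C^{q^n}: computational basis |x>, x in F_q^n, indexed by
   enum_val i for i : 'I_(dimH F n). *)
Notation dimH F n := #|{: 'rV[F]_n}|.
Notation basis F n i := (@enum_val _ (pred_of_simpl (@predT 'rV[F]_n)) i).

Definition trF (F : finFieldType) (p m : nat) (x : F) : F := \sum_(i < m) x ^+ (p ^ i).

(* xi^{tr(x)}, tr(x) in F_p identified with its representative in {0..p-1} *)
Definition chi (F : finFieldType) (p m : nat) (x : F) : CC :=
  xi p ^+ (odflt 0%N (omap val [pick k : 'I_p | (val k)%:R == trF p m x])).

Definition adj (M N : nat) (A : 'M[CC]_(M, N)) : 'M[CC]_(N, M) := (map_mx Num.conj A)^T.

(* E_{(a,b)} = tensor_j X(a_j) Z(b_j):  |x> |-> prod_j xi^{tr(b_j x_j)} |x + a> *)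
Definition pauliE (F : finFieldType) (p m n : nat) (a b : 'rV[F]_n) : 'M[CC]_(dimH F n) :=
  \matrix_(i, j) (if basis F n i == basis F n j + a
                  then \prod_(k < n) chi p m (b 0 k * (basis F n j) 0 k) else 0).

(* Gamma^I: the single-qudit channel Gamma applied on every qudit of I;
   expanded, Gamma^I(rho) = q^{-2|I|} sum_{a,b supported in I} E_{(a,b)} rho E_{(a,b)}^dagger *)
Definition GammaI (F : finFieldType) (p m n : nat) (I : {set 'I_n}) (rho : 'M[CC]_(dimH F n)) :
  'M[CC]_(dimH F n) :=
  ((#|F| ^ (2 * #|I|))%:R)^-1 *:
    \sum_(a : 'rV[F]_n | supp a \subset I) \sum_(b : 'rV[F]_n | supp b \subset I)
       (pauliE p m a b *m rho *m adj (pauliE p m a b)).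

(* an operator of the form Id_{qudits not in J} (x) A_J *)
Definition acts_on (F : finFieldType) (n : nat) (J : {set 'I_n}) (M : 'M[CC]_(dimH F n)) : Prop :=
  exists A : 'rV[F]_n -> 'rV[F]_n -> CC, forall i j,
    M i j = if restr (~: J) (basis F n i) == restr (~: J) (basis F n j)
            then A (restr J (basis F n i)) (restr J (basis F n j)) else 0.

(* (I,J)-local recoverability: there is a trace-preserving quantum operation
   (operator-sum / Kraus form, Kraus operators acting only on qudits in J)
   recovering Gamma^I(|phi><phi|) for every |phi> in Q. *)
Definition loc_recoverable (F : finFieldType) (p m n : nat) (Q : 'cV[CC]_(dimH F n) -> Prop)
  (I J : {set 'I_n}) : Prop :=
  exists (s : nat) (Kr : 'I_s -> 'M[CC]_(dimH F n)),
    [/\ forall k, acts_on J (Kr k),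
        \sum_(k < s) (adj (Kr k) *m Kr k) = 1%:M &
        forall phi, Q phi ->
          \sum_(k < s) (Kr k *m GammaI p m I (phi *m adj phi) *m adj (Kr k)) = phi *m adj phi].

Definition qLRC (F : finFieldType) (p m n : nat) (Q : 'cV[CC]_(dimH F n) -> Prop) (r delta : nat) : Prop :=
  forall i : 'I_n, exists J : {set 'I_n},
    [/\ i \in J, leq #|J| (subn (addn r delta) 1) &
      forall I : {set 'I_n}, I \proper J -> #|I| = subn delta 1 -> loc_recoverable p m Q I J].

(* Stabilizer group S generated by xi^l Id and E_y, y in D (D symplectic
   self-orthogonal, so S = {xi^l E_y}) *)
Definition inS (F : finFieldType) (p m n : nat) (D : {set 'rV[F]_n * 'rV[F]_n})
  (A : 'M[CC]_(dimH F n)) : Prop :=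
  exists (l : nat) (a b : 'rV[F]_n), (a, b) \in D /\ A = xi p ^+ l *: pauliE p m a b.

Definition stab_char (F : finFieldType) (p m n : nat) (D : {set 'rV[F]_n * 'rV[F]_n})
  (lam : 'M[CC]_(dimH F n) -> CC) : Prop :=
  (forall A B, inS p m D A -> inS p m D B -> lam (A *m B) = lam A * lam B) /\
  lam ((xi p)%:M) = xi p.

Definition stabQ (F : finFieldType) (p m n : nat) (D : {set 'rV[F]_n * 'rV[F]_n})
  (lam : 'M[CC]_(dimH F n) -> CC) (v : 'cV[CC]_(dimH F n)) : Prop :=
  forall A, inS p m D A -> A *m v = lam A *: v.

Definition normal_basis (F K : finFieldType) (iota : {rmorphism F -> K}) (q : nat) (vs : K) : Prop :=
  (forall a b : F, iota a * vs + iota b * vs ^+ q = 0 -> a = 0 /\ b = 0) /\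
  (forall x : K, exists a b : F, x = iota a * vs + iota b * vs ^+ q).

Definition psi (F K : finFieldType) (iota : {rmorphism F -> K}) (q : nat) (vs : K) (n : nat)
  (ab : 'rV[F]_n * 'rV[F]_n) : 'rV[K]_n :=
  vs *: map_mx iota ab.1 + vs ^+ q *: map_mx iota ab.2.
Definition Dherm (F K : finFieldType) (iota : {rmorphism F -> K}) (q : nat) (vs : K) (n : nat)
  (C : {set 'rV[K]_n}) : {set 'rV[F]_n * 'rV[F]_n} :=
  [set ab | psi iota q vs ab \in C].

Definition Deucl (F : finFieldType) (n : nat) (C : {set 'rV[F]_n}) : {set 'rV[F]_n * 'rV[F]_n} :=
  setX C C.

(* Main.v *)
(** Write [F = F_q], [V = F^n x F^n], [E_v] for the Pauli operator of [v] in [V],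
    [D] for the additive code defining the stabilizer group and [D'] for its dual
    with respect to the bicharacter [chi (symp u v)], so that
    [E_u E_v = chi (symp v u) E_v E_u].  Both cases reduce to the following: the
    code [Q] is [(I, J)]-locally recoverable iff every [v] in [D'] that vanishes on
    [J \ I] satisfies [v|_I \in D].

    If this holds, measure the syndrome of [D_J], the subcode of [D] supported in [J].
    By duality [(D_J)' = D' + V_(J^c)], so two errors on [I] with the same syndrome
    differ by the restriction to [I] of such a [v], hence by an element of [D], which
    acts on [Q] by a scalar: applying the inverse of any error on [I] with the
    observed syndrome restores the state.

    Conversely, if Kraus operators [K_k] on [J] recover [Q], then each [K_k E_u] with [u]
    supported in [I] maps every [phi] in [Q] to a multiple of [phi].  For [v] as above,
    [E_v] preserves [Q] and is, up to a phase, [E_w E_(v|_I)] with [w] supported off [J],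
    where [E_w] commutes with [K_k].  Comparing [K_k E_u E_v phi] with
    [K_k E_(u + v|_I) phi] shows that every [phi] in [Q] is an eigenvector of
    [E_(v|_I)], so [E_(v|_I)] is a nonzero scalar on [Q].  If [v|_I] were not in [D],
    the trace of [E_(v|_I)] on [Q] would vanish. *)

From Stdlib Require Import Rbase Rtrigo_def Rtrigo1 Lra.
Require Import Defs.
From HB Require Import structures.
From mathcomp Require Import all_boot all_order all_algebra.
From mathcomp Require Import complex finfield.
From mathcomp Require Import reals Rstruct.

Set Implicit Arguments.
Unset Strict Implicit.
Unset Printing Implicit Defensive.
Import Order.TTheory GRing.Theory Num.Theory.
Local Open Scope ring_scope.

(* The libraries imported above rebind the key [R] of [R_scope] to [ring_scope]. *)
Delimit Scope R_scope with coqR.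

(** * The additive character of a finite field *)

(* [^] on [nat] means [Nat.pow] in the definitions, but [expn] in the theorem. *)
Lemma Nat_powE a b : Nat.pow a b = (a ^ b)%N.
Proof. by elim: b => //= b ->; rewrite expnS. Qed.

Lemma xiX p k : xi p ^+ k =
  Complex (cos (INR k * (2 * PI / INR p))%coqR)
          (sin (INR k * (2 * PI / INR p))%coqR).
Proof.
elim: k => [|k IHk]; first by rewrite expr0 Rmult_0_l cos_0 sin_0.
rewrite exprS {}IHk S_INR Rmult_plus_distr_r Rmult_1_l Rplus_comm cos_plus sin_plus.
by rewrite /xi [LHS]/GRing.mul /= [X in Complex _ X]Rplus_comm.
Qed.

Lemma xi_expp p : (0 < p)%N -> xi p ^+ p = 1.
Proof.
move=> p_gt0; rewrite xiX.
have -> : (INR p * (2 * PI / INR p) = 2 * PI)%coqR.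
  by field; apply: not_0_INR => p0; rewrite p0 in p_gt0.
by rewrite cos_2PI sin_2PI.
Qed.

Lemma xi_expn_neq1 p k : (0 < k < p)%N -> xi p ^+ k != 1.
Proof.
case/andP=> k_gt0 ltkp; apply/eqP; rewrite xiX => -[cos1 _].
have kR : (0 < INR k)%coqR by apply/lt_0_INR/ssrnat.ltP.
have pR : (INR k < INR p)%coqR by apply/lt_INR/ssrnat.ltP.
(* Half the angle: [cos (2 * t) = 1 - 2 * sin t * sin t], and [0 < t < PI] makes [sin t] positive,
   so the cosine cannot be [1]. *)
pose t := (INR k * PI / INR p)%coqR.
have tE : (INR k * (2 * PI / INR p) = 2 * t)%coqR by rewrite /t; field; lra.
have t_gt0 : (0 < t)%coqR.
  by apply: Rdiv_lt_0_compat; [apply: Rmult_lt_0_compat => //; exact: PI_RGT_0 | lra].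
have t_ltPI : (t < PI)%coqR.
  apply: (Rmult_lt_reg_r (INR p)); first by lra.
  rewrite /t; have -> : (INR k * PI / INR p * INR p = INR k * PI)%coqR by field; lra.
  by rewrite Rmult_comm; apply: Rmult_lt_compat_l => //; exact: PI_RGT_0.
have st := sin_gt_0 t t_gt0 t_ltPI.
have c1 : (cos (2 * t) = 1)%coqR by rewrite -tE.
rewrite cos_2a_sin in c1.
have : (0 < sin t * sin t)%coqR by apply: Rmult_lt_0_compat.
lra.
Qed.

Lemma xi_conj p : xi p * (xi p)^* = 1.
Proof.
rewrite /xi; set t := (2 * PI / INR p)%coqR.
have := sin2_cos2 t; rewrite /Rsqr !RealsE.
set c := cos _; set s := sin _ => sc.
rewrite [LHS](_ : _ = Complex (c * c - s * - s) (c * - s + s * c)) //.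
by rewrite mulrN opprK addrC sc mulrN mulrC addNr.
Qed.

Section Character.
Context (p m : nat) (F : finFieldType).
Hypotheses (p_pr : prime p) (m_gt0 : (0 < m)%N) (cardF : #|F| = (p ^ m)%N).
Local Notation chi := (@chi F p m).

Let pchar_p : p \in [pchar F].
Proof. exact: card_finPcharP cardF p_pr. Qed.

Lemma trFE (x : F) : trF p m x = \sum_(i < m) x ^+ (p ^ i)%N.
Proof. by apply: eq_bigr => i _; rewrite Nat_powE. Qed.

Lemma trFD (x y : F) : trF p m (x + y) = trF p m x + trF p m y.
Proof.
rewrite !trFE -big_split; apply: eq_bigr => i _ /=.
have pi_nat : [pchar F].-nat (p ^ i)%N by rewrite pnatX pnatE // pchar_p.
by rewrite exprDn_pchar.
Qed.

(** The [p]-th power shifts the summands [x ^+ (p ^ i)] cyclically, because [x ^+ (p ^ m) = x] in a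
    field of [p ^ m] elements. *)
Lemma trF_Frobenius (x : F) : trF p m x ^+ p = trF p m x.
Proof.
rewrite !trFE -(pFrobenius_autE pchar_p) rmorph_sum.
case: m m_gt0 cardF => // k _ cardF'.
rewrite big_ord_recr [RHS]big_ord_recl addrC; congr (_ + _); last first.
  by rewrite /= pFrobenius_autE -exprM -expnSr -cardF' expf_card expr1.
by apply: eq_bigr => i _; rewrite /= pFrobenius_autE -exprM -expnSr.
Qed.

(** The [p] residues are already distinct roots of ['X^p - 'X]; one more root would exceed its
    degree. *)
Lemma Frobenius_fixedP (z : F) : z ^+ p = z -> exists2 k, (k < p)%N & z = k%:R.
Proof.
move=> zp; pose s := [seq (val i)%:R : F | i <- enum 'I_p].
have s_uniq : uniq s.
  rewrite map_inj_in_uniq ?enum_uniq // => i j _ _ /=.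
  wlog le_ij : i j / (i <= j)%N => [IH|].
    by case: (leqP i j) => [/IH //|/ltnW/IH h /esym/h].
  move/esym/eqP; rewrite -subr_eq0 -natrB // -(dvdn_pcharf pchar_p) => dv.
  apply/val_inj/eqP; rewrite eqn_leq le_ij /= -subn_eq0; apply/negPn/negP => n0.
  have := dvdn_leq _ dv; rewrite lt0n n0 => /(_ isT).
  by apply/negP; rewrite -ltnNge; exact: leq_ltn_trans (leq_subr _ _) (ltn_ord j).
case zs: (z \in s); first by case/mapP: zs => i _ ->; exists (val i); rewrite ?ltn_ord.
pose P : {poly F} := 'X^p - 'X.
have sP : size P = p.+1.
  by rewrite size_polyDl size_polyXn // size_polyN size_polyX ltnS prime_gt1.
have : (size (z :: s) < size P)%N.
  apply: max_poly_roots; first by rewrite -size_poly_eq0 sP.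
    apply/allP => y; rewrite inE => /orP[/eqP->|/mapP[i _ ->]].
      by rewrite /root !hornerE zp subrr.
    by rewrite /root !hornerE -(pFrobenius_autE pchar_p) pFrobenius_aut_nat subrr.
  by rewrite /= zs.
by rewrite sP /= size_map size_enum_ord ltnn.
Qed.


(** Frees [chi] from its [pick]: two representatives of the trace differ by a multiple of [p], and
    [xi p ^+ p = 1]. *)
Lemma chiE (x : F) k : trF p m x = k%:R -> chi x = xi p ^+ k.
Proof.
have p_gt0 := prime_gt0 p_pr.
have xi_mod j : xi p ^+ (j %% p) = xi p ^+ j by rewrite expr_mod // xi_expp.
have xi_eq i j : i%:R = j%:R :> F -> xi p ^+ i = xi p ^+ j.
  wlog le_ij : i j / (i <= j)%N => [IH|].
    by case: (leqP i j) => [/IH //|/ltnW/IH h /esym/h].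
  move/esym/eqP; rewrite -subr_eq0 -natrB // -(dvdn_pcharf pchar_p) => dv.
  by rewrite -(subnKC le_ij) exprD -[xi p ^+ (j - i)]xi_mod (eqP dv) mulr1.
move=> xk; rewrite /Defs.chi; case: pickP => [i /eqP|none] /=.
  by rewrite xk => /xi_eq.
have := none (Ordinal (ltn_pmod k p_gt0)).
by rewrite /= (GRing.natr_mod_pchar pchar_p) xk eqxx.
Qed.

Lemma chiP (x : F) : exists k, [/\ (k < p)%N, trF p m x = k%:R & chi x = xi p ^+ k].
Proof.
by have [k ltkp trk] := Frobenius_fixedP (trF_Frobenius x); exists k; split => //; apply: chiE.
Qed.

Lemma chiD (x y : F) : chi (x + y) = chi x * chi y.
Proof.
have [k [_ xk ->]] := chiP x; have [l [_ yl ->]] := chiP y.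
by rewrite -exprD; apply: chiE; rewrite trFD xk yl natrD.
Qed.

Lemma chi_unit (x : F) : chi x * (chi x)^* = 1.
Proof.
by have [k [_ _ ->]] := chiP x; rewrite rmorphXn -exprMn xi_conj expr1n.
Qed.

Lemma chi_neq0 (x : F) : chi x != 0.
Proof. by apply/eqP => x0; have /eqP := chi_unit x; rewrite x0 mul0r eq_sym oner_eq0. Qed.

Lemma chi0 : chi 0 = 1.
Proof. by apply: (mulfI (chi_neq0 0)); rewrite -chiD addr0 mulr1. Qed.

Lemma chiN (x : F) : chi (- x) = (chi x)^*.
Proof. by apply: (mulfI (chi_neq0 x)); rewrite -chiD subrr chi0 chi_unit. Qed.

Lemma chi_sum (I : Type) (r : seq I) (P : pred I) (f : I -> F) :
  chi (\sum_(i <- r | P i) f i) = \prod_(i <- r | P i) chi (f i).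
Proof. exact: (big_morph chi chiD chi0). Qed.

(** If [t] were nonzero, [c * t] would run over all of [F], so the trace would vanish everywhere.
    But the trace is a polynomial whose coefficient of ['X] is [1] and whose degree is at most
    [p ^ (m - 1)], less than the size of [F]. *)
Lemma chi_nontrivial (t : F) : (forall c, chi (c * t) = 1) -> t = 0.
Proof.
move=> chi1; apply/eqP/negPn/negP => t_neq0.
have tr0 (x : F) : trF p m x = 0.
  have [k [ltkp -> chik]] := chiP x; have := chi1 (x / t).
  rewrite divfK // chik; case: (posnP k) => [->//|k_gt0] /eqP.
  by rewrite (negPf (xi_expn_neq1 _)) // k_gt0.
have p_gt1 := prime_gt1 p_pr.
pose P : {poly F} := \sum_(i < m) 'X^(p ^ i).
have P_neq0 : P != 0.
  apply/eqP => /(congr1 (fun Q : {poly F} => Q`_1)) /eqP.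
  rewrite coef0 coef_sum; case: m m_gt0 => // k _.
  rewrite big_ord_recl coefXn eqxx big1 ?addr0 ?oner_eq0 // => i _.
  by rewrite coefXn /= ltn_eqF // -[1%N](expn0 p) ltn_exp2l.
have : (size (enum F) < size P)%N.
  apply: max_poly_roots => //; last exact: enum_uniq.
  apply/allP => x _; rewrite /root horner_sum; apply/eqP; rewrite -[RHS](tr0 x) trFE.
  by apply: eq_bigr => i _; rewrite hornerXn.
rewrite -cardE cardF ltnNge; case/negP.
apply: (leq_trans (size_sum _ _ _)); apply/bigmax_leqP => i _.
by rewrite size_polyXn ltn_exp2l.
Qed.

End Character.

(** * The trace-symplectic form *)

Lemma zmod_closed0 (V : zmodType) (W : {pred V}) : zmod_closed W -> 0 \in W.
Proof. by case. Qed.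

Lemma zmod_closed_opp (V : zmodType) (W : {pred V}) x : zmod_closed W -> x \in W -> - x \in W.
Proof. by case=> W0 WB xW; rewrite -[- x]add0r; apply: WB. Qed.

Lemma zmod_closed_add (V : zmodType) (W : {pred V}) x y :
  zmod_closed W -> x \in W -> y \in W -> x + y \in W.
Proof.
by move=> Wz xW yW; rewrite -[y]opprK; case: (Wz) => _; apply; rewrite ?zmod_closed_opp.
Qed.

Section SymplecticForm.
Context (F : finFieldType) (n : nat).
Implicit Types (u v w : 'rV[F]_n * 'rV[F]_n) (a b c : 'rV[F]_n).

Lemma euclC a b : eucl a b = eucl b a.
Proof. by apply: eq_bigr => k _; rewrite mulrC. Qed.

Lemma euclDl a b c : eucl (a + b) c = eucl a c + eucl b c.
Proof. by rewrite /eucl -big_split; apply: eq_bigr => k _; rewrite mxE mulrDl. Qed.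

Lemma euclZl x a b : eucl (x *: a) b = x * eucl a b.
Proof. by rewrite /eucl mulr_sumr; apply: eq_bigr => k _; rewrite mxE mulrA. Qed.

Lemma euclDr a b c : eucl a (b + c) = eucl a b + eucl a c.
Proof. by rewrite euclC euclDl !(euclC a). Qed.

Lemma euclNl a b : eucl (- a) b = - eucl a b.
Proof. by rewrite -scaleN1r euclZl mulN1r. Qed.

Lemma eucl0l a : eucl 0 a = 0.
Proof. by rewrite -(scale0r 0) euclZl mul0r. Qed.

Lemma eucl_delta x k a : eucl (x *: delta_mx 0 k) a = x * a 0 k.
Proof.
rewrite euclZl /eucl (bigD1 k) //= mxE !eqxx mul1r big1 ?addr0 // => j /negPf jk.
by rewrite mxE jk andbF mul0r.
Qed.

Definition symp u v : F := eucl u.1 v.2 - eucl u.2 v.1.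

Lemma symp_anti u v : symp u v = - symp v u.
Proof. by rewrite /symp opprB (euclC u.1) (euclC u.2). Qed.

Lemma sympDl u v w : symp (u + v) w = symp u w + symp v w.
Proof. by rewrite /symp !euclDl opprD addrACA. Qed.

Lemma sympDr u v w : symp w (u + v) = symp w u + symp w v.
Proof. by rewrite symp_anti sympDl opprD -!symp_anti. Qed.

Lemma sympNl u v : symp (- u) v = - symp u v.
Proof. by rewrite /symp !euclNl opprD. Qed.

Lemma symp0l u : symp 0 u = 0.
Proof. by rewrite /symp !eucl0l subr0. Qed.

Definition supported_in (J : {set 'I_n}) : {set 'rV[F]_n * 'rV[F]_n} :=
  [set v | (supp v.1 \subset J) && (supp v.2 \subset J)].

Lemma supp_subP (J : {set 'I_n}) a :
  reflect (forall k, k \notin J -> a 0 k = 0) (supp a \subset J).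
Proof.
apply: (iffP subsetP) => [aJ k kJ|aJ k].
  by apply/eqP/negPn/negP => ak; case/negP: kJ; apply: aJ; rewrite inE.
by rewrite inE; apply: contraR => /aJ ->.
Qed.

Lemma supported_inP (J : {set 'I_n}) v :
  reflect (forall k, k \notin J -> v.1 0 k = 0 /\ v.2 0 k = 0) (v \in supported_in J).
Proof.
rewrite inE; apply: (iffP andP) => [[/supp_subP aJ /supp_subP bJ] k kJ|vJ].
  by rewrite aJ ?bJ.
by split; apply/supp_subP => k /vJ[].
Qed.

Lemma supported_in_zmod J : zmod_closed (supported_in J).
Proof.
split=> [|u v /supported_inP uJ /supported_inP vJ]; apply/supported_inP => k kJ.
  by rewrite !mxE.
by rewrite !mxE; have [-> ->] := uJ k kJ; have [-> ->] := vJ k kJ; rewrite subrr.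
Qed.

End SymplecticForm.

(** * Duality of additive codes for the trace-symplectic bicharacter *)

Section TraceDual.
Context (p m : nat) (F : finFieldType) (n : nat).
Hypotheses (p_pr : prime p) (m_gt0 : (0 < m)%N) (cardF : #|F| = (p ^ m)%N).
Local Notation chi := (@chi F p m).
Local Notation V := ('rV[F]_n * 'rV[F]_n)%type.
Implicit Types (u v w : V) (W : {set V}).

(** Orthogonality is tested through [chi], not on [symp] itself, so that character sums apply to
    codes that are merely additive. *)
Definition tdual W : {set V} := [set v | [forall y in W, chi (symp y v) == 1]].

Lemma tdualP W v : reflect (forall y, y \in W -> chi (symp y v) = 1) (v \in tdual W).
Proof.
rewrite inE; apply: (iffP forallP) => vW y.
  by move=> yW; have /implyP/(_ yW)/eqP := vW y.
by apply/implyP => /vW ->.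
Qed.

Lemma tdual_zmod W : zmod_closed (tdual W).
Proof.
have chi0' := chi0 p_pr m_gt0 cardF.
split=> [|u v /tdualP uW /tdualP vW]; apply/tdualP => y yW.
  by rewrite symp_anti symp0l oppr0 chi0'.
rewrite sympDr (chiD p_pr m_gt0 cardF) uW // symp_anti sympNl -symp_anti.
by rewrite (chiN p_pr m_gt0 cardF) vW // rmorph1 mulr1.
Qed.

(** Orthogonality of characters: translating by some [y0] in [W] with [chi (symp y0 v) != 1]
    permutes the summands yet multiplies the sum by that value. *)
Lemma chi_sum_zmod W v : zmod_closed W ->
  \sum_(y in W) chi (symp y v) = if v \in tdual W then #|W|%:R else 0.
Proof.
move=> Wz; case: ifP => [/tdualP vW|/negbT].
  by rewrite (eq_bigr (fun=> 1)) // sumr_const.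
rewrite inE negb_forall => /existsP[y0]; rewrite negb_imply => /andP[y0W y0_neq1].
set S := LHS; have : S = chi (symp y0 v) * S.
  rewrite /S mulr_sumr (reindex_inj (addrI y0)) /=.
  apply: eq_big => [y|y _]; last by rewrite sympDl (chiD p_pr m_gt0 cardF).
  apply/idP/idP => yW; last exact: zmod_closed_add.
  by rewrite -(addKr y0 y) zmod_closed_add // zmod_closed_opp.
move/eqP; rewrite -subr_eq0 -{1}[S]mul1r -mulrBl mulf_eq0 subr_eq0 eq_sym.
by rewrite (negPf y0_neq1) => /eqP.
Qed.

Lemma chi_delta_eq0 (v : V) k :
    (forall x : F, chi (symp (x *: delta_mx 0 k, 0) v) = 1) ->
    (forall x : F, chi (symp (0, x *: delta_mx 0 k) v) = 1) ->
  v.1 0 k = 0 /\ v.2 0 k = 0.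
Proof.
move=> chi1 chi2; split; apply: (chi_nontrivial p_pr m_gt0 cardF) => x.
  have := chi2 (- x); rewrite /symp /= eucl0l sub0r eucl_delta.
  by rewrite mulNr opprK.
by have := chi1 x; rewrite /symp /= eucl0l subr0 eucl_delta.
Qed.

Lemma tdual_setT : tdual [set: V] = [set (0 : V)].
Proof.
apply/setP => v; rewrite in_set1; apply/tdualP/eqP => [vV|->]; last first.
  by move=> y _; rewrite symp_anti symp0l oppr0 (chi0 p_pr m_gt0 cardF).
have v0 k := chi_delta_eq0 (fun x => vV (x *: delta_mx 0 k, 0) (in_setT _))
                           (fun x => vV (0, x *: delta_mx 0 k) (in_setT _)).
case: v v0 {vV} => a b /= v0; congr (_, _); apply/rowP => k; rewrite mxE.
  by have [] := v0 k.
by have [] := v0 k.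
Qed.

(** Double counting of the sum of [chi (symp y v)] over [y] in [W] and all [v]. Summing over [y]
    first gives the left side; summing over [v] first leaves only [y = 0], by nondegeneracy
    ([tdual_setT]). *)
Lemma card_tdual W : zmod_closed W -> (#|W| * #|tdual W|)%N = #|{: V}|.
Proof.
move=> Wz; apply/eqP; rewrite -(eqr_nat CC); apply/eqP.
transitivity (\sum_v \sum_(y in W) chi (symp y v)).
  rewrite (eq_bigr _ (fun v _ => chi_sum_zmod v Wz)) -big_mkcond /= sumr_const.
  by rewrite natrM mulr_natr.
rewrite exchange_big /= (bigD1 (0 : V)) ?zmod_closed0 //= [X in _ + X]big1 => [|y /andP[_ y0]].
  rewrite addr0 (eq_bigr (fun=> 1)) ?sumr_const //.
  by move=> v _; rewrite symp0l (chi0 p_pr m_gt0 cardF).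
have Vz : zmod_closed [set: V] by split=> [|? ? _ _]; rewrite inE.
have : \sum_(v in [set: V]) chi (symp v (- y)) = 0.
  by rewrite chi_sum_zmod // tdual_setT in_set1 oppr_eq0 (negPf y0).
by move=> S0; rewrite -[RHS]S0; apply: eq_big => [v|v _]; rewrite ?inE // [in RHS]symp_anti sympNl opprK.
Qed.

(** [W] lies in its double dual, and two applications of [card_tdual] show that both have the same
    size. *)
Lemma tdualK W : zmod_closed W -> tdual (tdual W) = W.
Proof.
move=> Wz; apply/esym/eqP; rewrite eqEcard; apply/andP; split.
  apply/subsetP => y yW; apply/tdualP => v /tdualP vW.
  by rewrite symp_anti (chiN p_pr m_gt0 cardF) vW // rmorph1.
have W'_gt0 : (0 < #|tdual W|)%N.
  by apply/card_gt0P; exists (0 : V); apply: zmod_closed0 (tdual_zmod _).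
have cardW' := card_tdual (tdual_zmod W); have cardW := card_tdual Wz.
by rewrite -(leq_pmul2l W'_gt0) cardW' -cardW mulnC.
Qed.

Lemma tdual_supported_in J : tdual (supported_in F J) \subset supported_in F (~: J).
Proof.
apply/subsetP => v /tdualP vJ; apply/supported_inP => k; rewrite inE negbK => kJ.
have deltaJ x l : l \notin J -> (x *: delta_mx 0 k : 'rV[F]_n) 0 l = 0.
  by move=> lJ; rewrite !mxE (_ : l == k = false) ?andbF ?mulr0 //; apply: contraNF lJ => /eqP->.
apply: chi_delta_eq0 => x; apply: vJ; apply/supported_inP => l lJ;
  by rewrite /= deltaJ // mxE.
Qed.

(** [W] is the sum of [tdual D] and the vectors supported off [J]. Anything orthogonal to both
    summands lies in [D] and is supported in [J], so [e] lies in the double dual of [W], which is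
    [W]. *)
Lemma tdual_capP (D : {set V}) J e : zmod_closed D -> e \in tdual (D :&: supported_in F J) ->
  exists2 v, v \in tdual D & e - v \in supported_in F (~: J).
Proof.
move=> Dz eD.
pose W : {set V} := [set (x.1 + x.2 : V) | x : V * V in setX (tdual D) (supported_in F (~: J))].
have inW v w : v \in tdual D -> w \in supported_in F (~: J) -> v + w \in W.
  by move=> vD wJ; apply/imsetP; exists (v, w) => //; apply/setXP.
have Dz' := tdual_zmod D; have Jz := supported_in_zmod F (~: J).
have Wz : zmod_closed W.
  split=> [|_ _ /imsetP[[v w] /setXP[/= vD wJ] ->] /imsetP[[v' w'] /setXP[/= vD' wJ'] ->]].
    by rewrite -[0]addr0 inW // zmod_closed0.
  by rewrite opprD addrACA inW //; [case: Dz' => _; apply|case: Jz => _; apply].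
suff : e \in tdual (tdual W).
  rewrite tdualK // => /imsetP[[v w] /setXP[/= vD wJ] ->]; exists v => //.
  by rewrite addrC addKr.
apply/tdualP => y /tdualP yW; move/tdualP: eD; apply.
apply/setIP; split.
  rewrite -(tdualK Dz); apply/tdualP => v vD.
  by rewrite -[v]addr0 yW // inW // zmod_closed0.
rewrite -[J]setCK; apply: (subsetP (tdual_supported_in _)); apply/tdualP => w wJ.
by rewrite -[w]add0r yW // inW // zmod_closed0.
Qed.

End TraceDual.

(** * Pauli operators *)

Section Adjoint.

Lemma adjM M N L (A : 'M[CC]_(M, N)) (B : 'M_(N, L)) : adj (A *m B) = adj B *m adj A.
Proof. by rewrite /adj map_mxM trmx_mul. Qed.

Lemma adjK M N (A : 'M[CC]_(M, N)) : adj (adj A) = A.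
Proof. by apply/matrixP => i j; rewrite !mxE conjCK. Qed.

Lemma adjZ M N c (A : 'M[CC]_(M, N)) : adj (c *: A) = c^* *: adj A.
Proof. by rewrite /adj map_mxZ linearZ. Qed.

Lemma adjD M N (A B : 'M[CC]_(M, N)) : adj (A + B) = adj A + adj B.
Proof. by rewrite /adj map_mxD linearD. Qed.

Lemma adj0 M N : adj (0 : 'M[CC]_(M, N)) = 0.
Proof. by rewrite /adj map_mx0 trmx0. Qed.

Lemma adj_sum M N (I : Type) (r : seq I) (P : pred I) (A : I -> 'M[CC]_(M, N)) :
  adj (\sum_(i <- r | P i) A i) = \sum_(i <- r | P i) adj (A i).
Proof. exact: (big_morph _ (@adjD M N) (@adj0 M N)). Qed.

Lemma adj_mul_entry M N (A : 'M[CC]_(M, N)) j :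
  (adj A *m A) j j = \sum_i `|A i j| ^+ 2.
Proof. by rewrite mxE; apply: eq_bigr => i _; rewrite !mxE normCKC. Qed.

Lemma adj_mul_eq0 M N (A : 'M[CC]_(M, N)) : adj A *m A = 0 -> A = 0.
Proof.
move=> A0; apply/matrixP => i j; rewrite mxE.
have /eqP := adj_mul_entry A j; rewrite A0 mxE eq_sym psumr_eq0 => [|k _].
  by move=> /allP/(_ i (mem_index_enum _)); rewrite /= expf_eq0 normr_eq0 => /eqP.
exact: exprn_ge0.
Qed.

End Adjoint.

Section Pauli.
Context (p m : nat) (F : finFieldType) (n : nat).
Hypotheses (p_pr : prime p) (m_gt0 : (0 < m)%N) (cardF : #|F| = (p ^ m)%N).
Local Notation chi := (@chi F p m).
Local Notation V := ('rV[F]_n * 'rV[F]_n)%type.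
Local Notation N := (dimH F n).
Local Notation ket i := (basis F n i).
Implicit Types (u v w : V) (i j : 'I_N) (M : 'M[CC]_N).

Definition pauli u : 'M[CC]_N := pauliE p m u.1 u.2.

Definition idx (x : 'rV[F]_n) : 'I_N := enum_rank x.

Lemma ket_idx x : ket (idx x) = x.
Proof. exact: enum_rankK. Qed.

Lemma idx_ket i : idx (ket i) = i.
Proof. exact: enum_valK. Qed.

Lemma pauli_entry u i j :
  pauli u i j = if ket i == ket j + u.1 then chi (eucl u.2 (ket j)) else 0.
Proof. by rewrite mxE (chi_sum p_pr m_gt0 cardF). Qed.

Lemma mulmx_pauli M u i j :
  (M *m pauli u) i j = M i (idx (ket j + u.1)) * chi (eucl u.2 (ket j)).
Proof.
rewrite mxE (bigD1 (idx (ket j + u.1))) //= big1 ?addr0 => [|k neq_k].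
  by rewrite pauli_entry ket_idx eqxx.
rewrite pauli_entry; case: eqP => [kE|_]; last by rewrite mulr0.
by rewrite -kE idx_ket eqxx in neq_k.
Qed.

Lemma pauli_mulmx M u i j :
  (pauli u *m M) i j = chi (eucl u.2 (ket i - u.1)) * M (idx (ket i - u.1)) j.
Proof.
rewrite mxE (bigD1 (idx (ket i - u.1))) //= big1 ?addr0 => [|k neq_k].
  by rewrite pauli_entry ket_idx subrK eqxx.
rewrite pauli_entry; case: eqP => [iE|_]; last by rewrite mul0r.
by rewrite iE addrK idx_ket eqxx in neq_k.
Qed.

Lemma pauliM u v : pauli u *m pauli v = chi (eucl u.2 v.1) *: pauli (u + v).
Proof.
apply/matrixP => i j; rewrite mulmx_pauli [RHS]mxE !pauli_entry ket_idx /=.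
rewrite -addrA [v.1 + u.1]addrC; case: eqP => _; last by rewrite mul0r mulr0.
by rewrite -!(chiD p_pr m_gt0 cardF) euclDr euclDl addrA [eucl u.2 v.1 + _]addrC.
Qed.

Lemma pauli0 : pauli 0 = 1%:M.
Proof.
apply/matrixP => i j; rewrite pauli_entry [RHS]mxE addr0 (inj_eq enum_val_inj).
by case: eqP => // _; rewrite eucl0l (chi0 p_pr m_gt0 cardF).
Qed.

Lemma pauli_adj u : adj (pauli u) = chi (eucl u.2 u.1) *: pauli (- u).
Proof.
apply/matrixP => i j; rewrite /adj [LHS]mxE [LHS]mxE [RHS]mxE !pauli_entry /=.
rewrite -subr_eq eq_sym; case: eqP => [iE|_]; last by rewrite rmorph0 mulr0.
rewrite -(chiN p_pr m_gt0 cardF) -(chiD p_pr m_gt0 cardF) iE; congr (Defs.chi _ _ _).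
by rewrite !euclNl euclDr (euclC _ (- _)) euclNl opprD opprK addrC euclC.
Qed.

Lemma pauli_unitaryl u : adj (pauli u) *m pauli u = 1%:M.
Proof.
rewrite pauli_adj -scalemxAl pauliM scalerA -(chiD p_pr m_gt0 cardF) /= euclNl subrr.
by rewrite (chi0 p_pr m_gt0 cardF) scale1r addNr pauli0.
Qed.

Lemma pauli_unitaryr u : pauli u *m adj (pauli u) = 1%:M.
Proof. exact: mulmx1C (pauli_unitaryl u). Qed.

Lemma pauli_mulKmx L u (A : 'M[CC]_(N, L)) : pauli u *m (adj (pauli u) *m A) = A.
Proof. by rewrite mulmxA pauli_unitaryr mul1mx. Qed.

Lemma pauli_adjKmx L u (A : 'M[CC]_(N, L)) : adj (pauli u) *m (pauli u *m A) = A.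
Proof. by rewrite mulmxA pauli_unitaryl mul1mx. Qed.

Lemma pauli_comm u v : pauli u *m pauli v = chi (symp v u) *: (pauli v *m pauli u).
Proof.
rewrite !pauliM scalerA -(chiD p_pr m_gt0 cardF) [v + u]addrC; congr (_ *: _).
by congr (Defs.chi _ _ _); rewrite /symp subrK euclC.
Qed.

Lemma pauli_conj u v : pauli u *m pauli v *m adj (pauli u) = chi (symp v u) *: pauli v.
Proof. by rewrite pauli_comm -scalemxAl -mulmxA pauli_unitaryr mulmx1. Qed.

(** Conjugation by any [pauli v] preserves the trace but multiplies [pauli u] by [chi (symp u v)]. A
    nonzero trace would thus put [u] in the dual of the whole space, which is zero. *)
Lemma mxtrace_pauli u : u != 0 -> \tr (pauli u) = 0.
Proof.
move=> u_neq0; apply/eqP/negPn/negP => tr_neq0; case/negP: u_neq0.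
rewrite -in_set1 -(tdual_setT _ p_pr m_gt0 cardF); apply/tdualP => v _.
have : \tr (pauli v *m pauli u *m adj (pauli v)) = \tr (pauli u).
  by rewrite mxtrace_mulC mulmxA pauli_unitaryl mul1mx.
rewrite pauli_conj mxtraceZ -[RHS]mul1r => /(mulIf tr_neq0).
by rewrite symp_anti (chiN p_pr m_gt0 cardF) => /(congr1 Num.conj); rewrite conjCK rmorph1.
Qed.

Lemma pauli_acts_on u (J : {set 'I_n}) : u \in supported_in F J -> acts_on J (pauli u).
Proof.
move/supported_inP => uJ.
exists (fun x y => if x == y + u.1 then chi (eucl u.2 y) else 0) => i j.
rewrite pauli_entry.
(* Since [u.1] vanishes off [J], the shift by [u.1] can be tested separately on and off [J]. *)
have restrE : (ket i == ket j + u.1) =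
    (restr (~: J) (ket i) == restr (~: J) (ket j)) &&
    (restr J (ket i) == restr J (ket j) + u.1).
  apply/eqP/andP => [->|[/eqP/rowP eJ' /eqP/rowP eJ]].
    split; apply/eqP/rowP => k; rewrite !mxE ?inE; case: (boolP (k \in J)) => //= kJ.
      by rewrite (uJ k kJ).1 addr0.
    by rewrite (uJ k kJ).1 addr0.
  apply/rowP => k; have := eJ' k; have := eJ k; rewrite !mxE inE.
  by case: (boolP (k \in J)) => //= kJ _ ->; rewrite (uJ k kJ).1 addr0.
rewrite restrE; case: eqP => //= _; case: eqP => // _; congr (Defs.chi _ _ _).
apply: eq_bigr => k _; rewrite mxE; case: (boolP (k \in J)) => // kJ.
by rewrite (uJ k kJ).2 !mul0r.
Qed.

Lemma acts_on_sum (I : finType) (P : pred I) (J : {set 'I_n}) (c : I -> CC) (M : I -> 'M[CC]_N) :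
  (forall k, P k -> acts_on J (M k)) -> acts_on J (\sum_(k | P k) c k *: M k).
Proof.
move=> MJ; pose A0 := fun _ _ : 'rV[F]_n => 0 : CC.
have [A AE] : exists A : I -> 'rV[F]_n -> 'rV[F]_n -> CC, forall k, P k -> forall i j,
    M k i j = if restr (~: J) (ket i) == restr (~: J) (ket j)
              then A k (restr J (ket i)) (restr J (ket j)) else 0.
  (* Finite choice needs a witness for every [k]; outside [P] the premise of [R] is false and the
     dummy [A0] serves. *)
  pose R k (A : 'rV[F]_n -> 'rV[F]_n -> CC) := P k -> forall i j,
    M k i j = if restr (~: J) (ket i) == restr (~: J) (ket j)
              then A (restr J (ket i)) (restr J (ket j)) else 0.
  have [|A AR] := @fin_all_exists I (fun=> 'rV[F]_n -> 'rV[F]_n -> CC) R.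
    by move=> k; case Pk: (P k); [have [A AE] := MJ k Pk; exists A | exists A0; rewrite /R Pk].
  by exists A.
exists (fun x y => \sum_(k | P k) c k * A k x y) => i j.
rewrite summxE; case: ifP => ij; last first.
  by apply: big1 => k Pk; rewrite mxE AE // ij mulr0.
by apply: eq_bigr => k Pk; rewrite mxE AE // ij.
Qed.

Lemma acts_on_comm (J : {set 'I_n}) M u : acts_on J M -> u \in supported_in F (~: J) ->
  M *m pauli u = pauli u *m M.
Proof.
case=> A AE /supported_inP uJ; apply/matrixP => i j; rewrite mulmx_pauli pauli_mulmx.
have uJ0 k : k \in J -> u.1 0 k = 0 /\ u.2 0 k = 0.
  by move=> kJ; apply: uJ; rewrite inE negbK.
have restrD x : restr J (x + u.1) = restr J x.
  by apply/rowP => k; rewrite !mxE; case: ifP => // /uJ0[-> _]; rewrite addr0.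
have restrB x : restr J (x - u.1) = restr J x by rewrite -[LHS]restrD subrK.
have restrC x y : (restr (~: J) x == restr (~: J) (y + u.1)) =
                  (restr (~: J) (x - u.1) == restr (~: J) y).
  by apply/eqP/eqP => /rowP e; apply/rowP => k; have := e k; rewrite !mxE;
    case: ifP => // _; [move=> ->; rewrite addrK | move/eqP; rewrite subr_eq => /eqP].
rewrite !AE !ket_idx restrD restrB restrC; case: eqP => [/rowP e|_]; last first.
  by rewrite mul0r mulr0.
rewrite mulrC; congr (Defs.chi _ _ _ * _); apply: eq_bigr => k _.
have := e k; rewrite !mxE inE; case: (boolP (k \in J)) => /= kJ; last by move=> ->.
by rewrite (uJ0 k kJ).2 !mul0r.
Qed.

End Pauli.

(** * Stabilizer codes *)

(** Compare a fixed nonzero column of [B] with another column through their sum, which is also an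
    eigenvector or zero: either the two eigenvalues agree or the columns are proportional. *)
Lemma eigen_scalar (K : fieldType) (M L : nat) (A : 'M[K]_M) (B : 'M[K]_(M, L)) :
    (forall x : 'cV_L, exists c, A *m (B *m x) = c *: (B *m x)) ->
  exists c, A *m B = c *: B.
Proof.
move=> eigB.
have {}eigB (x : 'cV_L) : exists c, A *m (B *m x) == c *: (B *m x).
  by have [c /eqP] := eigB x; exists c.
have [->|] := eqVneq B 0; first by exists 0; rewrite mulmx0 scaler0.
case/matrix0Pn => i0 [j0 Bij].
pose e j : 'cV[K]_L := delta_mx j 0.
have Bj0 : B *m e j0 != 0.
  by apply/eqP => /matrixP/(_ i0 0); rewrite -colE !mxE => /eqP; apply/negP.
have [c0 /eqP c0E] := eigB (e j0).
exists c0.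
suff colE' j : A *m (B *m e j) = c0 *: (B *m e j).
  apply/matrixP => i j.
  have : col j (A *m B) = col j (c0 *: B) by rewrite !colE -mulmxA -scalemxAl colE'.
  by move/matrixP/(_ i 0); rewrite mxE [X in _ = X]mxE.
have [cj /eqP cjE] := eigB (e j); have [c /eqP] := eigB (e j0 + e j).
rewrite !mulmxDr c0E cjE scalerDr => /eqP.
rewrite -subr_eq0 opprD addrACA -!scalerBl addr_eq0 -scaleNr opprB => /eqP dep.
have [cE|c_neq] := eqVneq c cj.
  move: dep; rewrite cE subrr scale0r => /eqP; rewrite scaler_eq0 (negPf Bj0) orbF subr_eq0.
  by move=> /eqP ->.
rewrite -cjE; have -> : B *m e j = ((c - cj)^-1 * (c0 - c)) *: (B *m e j0).
  by rewrite -scalerA dep scalerA mulVf ?scale1r // subr_eq0.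
by rewrite -scalemxAr c0E !scalerA mulrC.
Qed.

(** Sandwiching the equation between [adj eta] and [eta] for [eta] orthogonal to [phi] gives a
    vanishing sum of squared moduli. So each [psi k] is orthogonal to the whole complement of
    [phi]. *)
Lemma rank_one_sum (M : nat) (I : finType) (P : pred I) (c : CC)
    (psi : I -> 'cV[CC]_M) (phi : 'cV[CC]_M) :
    0 < c -> c *: (\sum_(k | P k) psi k *m adj (psi k)) = phi *m adj phi ->
  forall k, P k -> exists a, psi k = a *: phi.
Proof.
move=> c_gt0 sumE k Pk.
have orth (eta : 'cV_M) : adj eta *m phi = 0 -> adj eta *m psi k = 0.
  move=> eta_phi.
  have : \sum_(l | P l) `|(adj eta *m psi l) 0 0| ^+ 2 = 0.
    apply: (mulfI (lt0r_neq0 c_gt0)); rewrite mulr0.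
    transitivity ((adj eta *m (phi *m adj phi) *m eta) 0 0); last first.
      by rewrite mulmxA eta_phi !mul0mx mxE.
    rewrite -sumE -scalemxAr -scalemxAl mxE; congr (_ * _).
    rewrite mulmx_sumr mulmx_suml summxE; apply: eq_bigr => l _.
    have -> : adj eta *m (psi l *m adj (psi l)) *m eta =
              adj eta *m psi l *m adj (adj eta *m psi l).
      by rewrite adjM adjK !mulmxA.
    by rewrite [RHS]mxE big_ord1 [adj (_ *m _) _ _]mxE [map_mx _ _ _ _]mxE normCK.
  move/eqP; rewrite psumr_eq0 => [|l _]; last exact: exprn_ge0.
  move=> /allP/(_ k (mem_index_enum _)); rewrite Pk expf_eq0 normr_eq0 /= => /eqP eq0.
  by rewrite [LHS]mx11_scalar eq0 raddf0.
(* The coefficient of the orthogonal projection onto [phi]. If [phi = 0], the quotient is a default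
   value and the orthogonality below is trivial. *)
pose a := (adj phi *m psi k) 0 0 / (adj phi *m phi) 0 0; exists a.
apply/eqP; rewrite -subr_eq0; apply/eqP; set eta := psi k - a *: phi.
have phi_eta : adj phi *m eta = 0.
  have [->|phi_neq0] := eqVneq phi 0; first by rewrite adj0 mul0mx.
  have nz : (adj phi *m phi) 0 0 != 0.
    apply: contraNneq phi_neq0 => eq0; apply/eqP/adj_mul_eq0.
    by rewrite [LHS]mx11_scalar eq0 raddf0.
  rewrite mulmxBr -scalemxAr [adj phi *m psi k]mx11_scalar [adj phi *m phi]mx11_scalar.
  by rewrite scale_scalar_mx divfK // subrr.
have eta_phi : adj eta *m phi = 0 by rewrite -[phi]adjK -adjM phi_eta adj0.
by apply: adj_mul_eq0; rewrite {2}/eta mulmxBr orth // -scalemxAr eta_phi scaler0 subrr.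
Qed.

Section Stabilizer.
Context (p m : nat) (F : finFieldType) (n : nat).
Hypotheses (p_pr : prime p) (m_gt0 : (0 < m)%N) (cardF : #|F| = (p ^ m)%N).
Local Notation chi := (@chi F p m).
Local Notation V := ('rV[F]_n * 'rV[F]_n)%type.
Local Notation N := (dimH F n).
Local Notation pauli := (@pauli p m F n).
Context (D : {set V}) (lam : 'M[CC]_N -> CC).
Hypotheses (Dz : zmod_closed D) (lamP : stab_char p m D lam).
Local Notation Q := (stabQ p m D lam).

Let inS_pauli l y : y \in D -> inS p m D (xi p ^+ l *: pauli y).
Proof. by move=> yD; exists l, y.1, y.2; rewrite -surjective_pairing. Qed.

Let inS_pauli1 y : y \in D -> inS p m D (pauli y).
Proof. by move=> yD; rewrite -[pauli y]scale1r -(expr0 (xi p)); apply: inS_pauli. Qed.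

Let D0 : 0 \in D.
Proof. exact: zmod_closed0. Qed.

Let xi_neq0 : xi p != 0.
Proof. by apply/eqP => xi0; have /eqP := xi_conj p; rewrite xi0 mul0r eq_sym oner_eq0. Qed.

Let scalarE c : c%:M = c *: pauli 0 :> 'M[CC]_N.
Proof. by rewrite pauli0 // scalemx1. Qed.

(** [stab_char] prescribes [lam] only at [xi p]. The value at the identity follows by cancelling
    [xi p], the others by multiplicativity. *)
Lemma lam_scalar l : lam ((xi p ^+ l)%:M) = xi p ^+ l.
Proof.
have inSs k : inS p m D (xi p ^+ k)%:M by rewrite scalarE; apply: inS_pauli.
have [lamM lam_xi] := lamP; have lamM_xi k : lam ((xi p ^+ k.+1)%:M) = lam ((xi p ^+ k)%:M) * xi p.
  by rewrite exprSr scalar_mxM lamM ?lam_xi //; exact: (inSs 1%N).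
elim: l => [|l IHl]; last by rewrite lamM_xi IHl exprSr.
by apply: (mulIf xi_neq0); rewrite -lamM_xi expr0 expr1 mul1r.
Qed.

Lemma lam_scale l y : y \in D -> lam (xi p ^+ l *: pauli y) = xi p ^+ l * lam (pauli y).
Proof.
move=> yD; rewrite -[in RHS]lam_scalar -mul_scalar_mx; apply: lamP.1; last exact: inS_pauli1.
by rewrite scalarE; apply: inS_pauli.
Qed.

Lemma lam_pauliM y z : y \in D -> z \in D ->
  lam (pauli y) * lam (pauli z) = chi (eucl y.2 z.1) * lam (pauli (y + z)).
Proof.
move=> yD zD; rewrite -(lamP.1 _ _ (inS_pauli1 yD) (inS_pauli1 zD)) pauliM //.
have [k [_ _ ->]] := chiP p_pr m_gt0 cardF (eucl y.2 z.1).
by rewrite lam_scale // zmod_closed_add.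
Qed.

Lemma lam_pauli_neq0 y : y \in D -> lam (pauli y) != 0.
Proof.
move=> yD; have := lam_pauliM yD (zmod_closed_opp Dz yD); rewrite subrr pauli0 //.
rewrite -(expr0 (xi p)) lam_scalar expr0 mulr1 => yNy.
apply/eqP => y0; have := chi_neq0 p_pr m_gt0 cardF (eucl y.2 (- y).1).
by rewrite -yNy y0 mul0r eqxx.
Qed.

Lemma stabQP (v : 'cV_N) :
  Q v <-> forall y, y \in D -> pauli y *m v = lam (pauli y) *: v.
Proof.
split=> [Qv y yD | Qv _ [l [a [b [abD ->]]]]]; first exact/Qv/inS_pauli1.
have ab : lam (xi p ^+ l *: pauliE p m a b) = _ := lam_scale l abD.
by rewrite ab -scalemxAl -scalerA; congr (_ *: _); apply: (Qv (a, b)).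
Qed.

(** The group average that projects orthogonally onto the code. It uses the inverse of [lam], not
    its conjugate, because [lam_pauli_norm] is itself derived from this operator being nonzero. *)
Definition stab_proj : 'M[CC]_N :=
  (#|D|%:R)^-1 *: \sum_(y in D) (lam (pauli y))^-1 *: pauli y.
Local Notation P := stab_proj.

Let cardD_neq0 : #|D|%:R != 0 :> CC.
Proof. by rewrite pnatr_eq0 -lt0n; apply/card_gt0P; exists (0 : V). Qed.

Lemma pauli_stab_proj z : z \in D -> pauli z *m P = lam (pauli z) *: P.
Proof.
move=> zD; rewrite -scalemxAr scalerA mulrC -scalerA; congr (_ *: _).
rewrite mulmx_sumr scaler_sumr [RHS](reindex_inj (addrI z)) /=.
apply: eq_big => [y|y yD].
  apply/idP/idP => [yD|zyD]; first exact: zmod_closed_add.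
  by rewrite -(addKr z y) zmod_closed_add // zmod_closed_opp.
rewrite -scalemxAr pauliM // !scalerA; congr (_ *: _).
have zyD := zmod_closed_add Dz zD yD; have := lam_pauliM zD yD.
move: (lam_pauli_neq0 zyD) (lam_pauli_neq0 yD).
move: (lam _) (lam (pauli y)) (lam _) => gzy gy gz gzy0 gy0 E.
apply: (mulfI gy0); rewrite mulVKf //; apply: (mulIf gzy0).
by rewrite -E mulrA mulfVK // mulrC.
Qed.

Lemma stab_proj_mem x : Q (P *m x).
Proof. by apply/stabQP => y yD; rewrite mulmxA pauli_stab_proj // scalemxAl. Qed.

(** Each product [pauli u *m pauli y] is a phase times [pauli (u + y)], and [u + y] is nonzero for
    [y] in [D]. *)
Lemma mxtrace_pauli_proj u : u \notin D -> \tr (pauli u *m P) = 0.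
Proof.
move=> uD; rewrite -scalemxAr mxtraceZ mulmx_sumr raddf_sum big1 ?mulr0 //= => y yD.
rewrite -scalemxAr mxtraceZ pauliM // mxtraceZ mxtrace_pauli ?mulr0 //.
by apply: contraNneq uD => /eqP; rewrite addr_eq0 => /eqP ->; apply: zmod_closed_opp.
Qed.

Lemma mxtrace_stab_proj_neq0 : \tr P != 0.
Proof.
rewrite mxtraceZ mulf_neq0 ?invr_neq0 // raddf_sum (bigD1 (0 : V)) //=.
rewrite big1 ?addr0 => [|y /andP[_ y0]]; last by rewrite mxtraceZ mxtrace_pauli ?mulr0.
rewrite mxtraceZ mulf_neq0 ?invr_neq0 ?lam_pauli_neq0 // pauli0 // mxtrace1 pnatr_eq0 -lt0n.
by apply/card_gt0P; exists 0.
Qed.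

Lemma stab_proj_neq0 : P != 0.
Proof. by apply: contraNneq mxtrace_stab_proj_neq0 => ->; rewrite mxtrace0. Qed.

(** A unitary can act on the nonzero matrix [P] as a scalar only if that scalar has modulus one. *)
Lemma lam_pauli_norm y : y \in D -> lam (pauli y) * (lam (pauli y))^* = 1.
Proof.
move=> yD; set g := lam _; apply/eqP; rewrite -subr_eq0; apply/eqP.
have PP_neq0 : adj P *m P != 0 by apply: contraNneq stab_proj_neq0 => /adj_mul_eq0 ->.
suff /eqP : (g * g^* - 1) *: (adj P *m P) = 0.
  by rewrite scaler_eq0 (negPf PP_neq0) orbF => /eqP.
rewrite scalerBl scale1r; apply/eqP; rewrite subr_eq0 mulrC.
rewrite -scalerA scalemxAr scalemxAl -adjZ -pauli_stab_proj // adjM -mulmxA.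
by rewrite [adj (pauli y) *m _]mulmxA pauli_unitaryl // mul1mx.
Qed.

Lemma stab_proj_adj_mul : adj P *m P = P.
Proof.
rewrite {1}/stab_proj adjZ adj_sum -scalemxAl mulmx_suml.
rewrite (eq_bigr (fun=> P)) => [|y yD].
  by rewrite sumr_const fmorphV rmorph_nat -[P *+ _]scaler_nat scalerA mulVf // scale1r.
have g0 := lam_pauli_neq0 yD; rewrite adjZ -scalemxAl fmorphV.
have -> : adj (pauli y) *m P = (lam (pauli y))^-1 *: P.
  apply: (scalerI g0); rewrite scalerA mulfV // scale1r scalemxAr -pauli_stab_proj //.
  by rewrite mulmxA pauli_unitaryl // mul1mx.
by rewrite scalerA -invfM mulrC lam_pauli_norm // invr1 scale1r.
Qed.

Lemma stab_tdual v (phi : 'cV_N) : v \in tdual p m D -> Q phi -> Q (pauli v *m phi).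
Proof.
move=> /tdualP vD /stabQP Qphi; apply/stabQP => y yD.
rewrite mulmxA pauli_comm // symp_anti (chiN p_pr m_gt0 cardF) vD // rmorph1 scale1r.
by rewrite -mulmxA Qphi // scalemxAr.
Qed.

Lemma stab_proj_conj e : pauli e *m P *m adj (pauli e) =
  (#|D|%:R)^-1 *: \sum_(y in D) ((lam (pauli y))^-1 * chi (symp y e)) *: pauli y.
Proof.
rewrite -scalemxAr -scalemxAl mulmx_sumr mulmx_suml; congr (_ *: _).
by apply: eq_bigr => y _; rewrite -scalemxAr -scalemxAl pauli_conj // scalerA.
Qed.

(* [E_e P E_e^*] projects onto the vectors on which [D] has the syndrome of [e]. *)
Lemma syndrome_proj e u (phi : 'cV_N) : Q phi ->
  pauli e *m P *m adj (pauli e) *m (pauli u *m phi) =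
  if e - u \in tdual p m D then pauli u *m phi else 0.
Proof.
move=> /stabQP Qphi.
rewrite stab_proj_conj -scalemxAl mulmx_suml (eq_bigr (fun y => chi (symp y (e - u)) *: (pauli u *m phi))).
  rewrite -scaler_suml chi_sum_zmod // scalerA; case: ifP => _.
    by rewrite mulVf // scale1r.
  by rewrite mulr0 scale0r.
move=> y yD; rewrite -scalemxAl mulmxA pauli_comm // -scalemxAl -mulmxA Qphi //.
rewrite -scalemxAr !scalerA; congr (_ *: _).
rewrite sympDr (chiD p_pr m_gt0 cardF) [symp y (- u)]symp_anti sympNl opprK.
by rewrite -!mulrA [_ * lam _]mulrC mulrA mulrCA -!mulrA mulVKf ?lam_pauli_neq0.
Qed.

(** Summing the phases over all [e] kills every [y] in [D] but [0]. The constant is [#|tdual D|],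
    the number of [e] sharing one syndrome. *)
Lemma sum_syndrome_proj : \sum_(e : V) pauli e *m P *m adj (pauli e) =
  (#|{: V}|%:R / #|D|%:R)%:M.
Proof.
have chi_sumV y : \sum_(e : V) chi (symp y e) = if y == 0 then #|{: V}|%:R else 0.
  have Vz : zmod_closed [set: V] by split=> [|? ? _ _]; rewrite inE.
  have := chi_sum_zmod p_pr m_gt0 cardF (- y) Vz.
  rewrite (tdual_setT n p_pr m_gt0 cardF) in_set1 oppr_eq0 cardsT => <-.
  by apply: eq_big => [e|e _]; rewrite ?inE // [in RHS]symp_anti sympNl opprK.
transitivity ((#|D|%:R)^-1 *:
    \sum_(y in D) ((lam (pauli y))^-1 * \sum_(e : V) chi (symp y e)) *: pauli y).
  rewrite (eq_bigr _ (fun e _ => stab_proj_conj e)) -scaler_sumr exchange_big /=.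
  by congr (_ *: _); apply: eq_bigr => y _; rewrite -scaler_suml mulr_sumr.
rewrite (bigD1 (0 : V)) //= [X in _ *: (_ + X)]big1 ?addr0 => [|y /andP[_ y0]].
  rewrite chi_sumV eqxx pauli0 // (lam_scalar 0 : lam 1%:M = 1) invr1 mul1r.
  by rewrite !scalemx1 scale_scalar_mx mulrC.
by rewrite chi_sumV (negPf y0) mulr0 scale0r.
Qed.

End Stabilizer.

(** * Local recovery *)

Lemma conjMC (x y : CC) : (x * y)^* = x^* * y^*.
Proof. exact: rmorphM. Qed.

Lemma sum_enum_val (T : finType) (A : nmodType) (f : T -> A) :
  \sum_(k < #|T|) f (enum_val k) = \sum_x f x.
Proof. by rewrite -(big_enum_val f). Qed.

Section Recovery.
Context (p m : nat) (F : finFieldType) (n : nat).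
Hypotheses (p_pr : prime p) (m_gt0 : (0 < m)%N) (cardF : #|F| = (p ^ m)%N).
Local Notation chi := (@chi F p m).
Local Notation V := ('rV[F]_n * 'rV[F]_n)%type.
Local Notation N := (dimH F n).
Local Notation pauli := (@pauli p m F n).
Local Notation tdual := (@tdual p m F n).

Lemma card_supp_sub (I : {set 'I_n}) :
  #|[set a : 'rV[F]_n | supp a \subset I]| = (#|F| ^ #|I|)%N.
Proof.
rewrite -[RHS](card_pffun_on (0 : F) I predT).
pose f (a : 'rV[F]_n) : {ffun 'I_n -> F} := [ffun k => a 0 k].
have f_inj : injective f.
  by move=> a b /ffunP ab; apply/rowP => k; have := ab k; rewrite !ffunE.
rewrite -(card_imset _ f_inj); apply: eq_card => g; apply/imsetP/pffun_onP.
  case=> a; rewrite inE => /supp_subP aI ->; split=> //.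
  by apply/supportP => k /aI; rewrite ffunE.
case=> /supportP gI _; exists (\row_k g k); last by apply/ffunP => k; rewrite ffunE mxE.
by rewrite inE; apply/supp_subP => k kI; rewrite mxE gI.
Qed.

(** Written with [Nat.pow] to match the normalisation in [GammaI]. *)
Lemma card_supported_in (I : {set 'I_n}) :
  #|supported_in F I| = Nat.pow #|F| (2 * #|I|).
Proof.
rewrite Nat_powE mulnC expnM expnS expn1 -card_supp_sub -cardsX.
by apply: eq_card => -[a b]; rewrite !inE.
Qed.

Lemma GammaIE (I : {set 'I_n}) (rho : 'M[CC]_N) : GammaI p m I rho =
  (#|supported_in F I|%:R)^-1 *:
    \sum_(u in supported_in F I) pauli u *m rho *m adj (pauli u).
Proof.
rewrite card_supported_in; congr (_ *: _); rewrite pair_big /=.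
by apply: eq_bigl => -[a b]; rewrite inE.
Qed.

Lemma card_supported_in_gt0 (I : {set 'I_n}) : 0 < #|supported_in F I|%:R :> CC.
Proof.
rewrite ltr0n; apply/card_gt0P; exists 0.
exact: zmod_closed0 (supported_in_zmod _ _).
Qed.

Lemma sub_supported_in (I J : {set 'I_n}) (u : V) :
  I \subset J -> u \in supported_in F I -> u \in supported_in F J.
Proof. by move=> IJ; rewrite !inE => /andP[aI bI]; rewrite !(subset_trans _ IJ). Qed.

Definition restr2 (I : {set 'I_n}) (v : V) : V := (restr I v.1, restr I v.2).

Lemma restr2_supported I v : restr2 I v \in supported_in F I.
Proof. by apply/supported_inP => k /negPf kI; rewrite !mxE kI. Qed.

Lemma supported_in_off (I J : {set 'I_n}) (v : V) :
    (forall k, k \in J -> k \notin I -> v.1 0 k = 0 /\ v.2 0 k = 0) ->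
  v - restr2 I v \in supported_in F (~: J).
Proof.
move=> vJI; apply/supported_inP => k; rewrite inE negbK => kJ; rewrite !mxE.
case: (boolP (k \in I)) => kI; first by rewrite !subrr.
by have [-> ->] := vJI k kJ kI; rewrite !subr0.
Qed.

Context (D : {set V}) (lam : 'M[CC]_N -> CC).
Hypotheses (Dz : zmod_closed D) (lamP : stab_char p m D lam).
Local Notation Q := (stabQ p m D lam).

(** Such a [v] looks, within [J], like an error on [I] that the checks supported in [J] cannot see;
    it must act trivially on the code. *)
Definition local_trivial (I J : {set 'I_n}) : Prop :=
  forall v, v \in tdual D ->
    (forall k, k \in J -> k \notin I -> v.1 0 k = 0 /\ v.2 0 k = 0) ->
  restr2 I v \in D.

(** * Recovery by measuring the local syndrome *)

Section Sufficiency.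
Context (I J : {set 'I_n}) (IJ : I \subset J) (IJtriv : local_trivial I J).

Let DJ := D :&: supported_in F J.
Local Notation PJ := (stab_proj p m DJ lam).

Let DJz : zmod_closed DJ.
Proof.
have [J0 JB] := supported_in_zmod F J; have [D0 DB] := Dz.
split=> [|u v /setIP[uD uJ] /setIP[vD vJ]]; apply/setIP; first by [].
by split; [apply: DB | apply: JB].
Qed.

Let inS_DJ A : inS p m DJ A -> inS p m D A.
Proof. by case=> l [a [b [/setIP[abD _] ->]]]; exists l, a, b. Qed.

Let lamJ : stab_char p m DJ lam.
Proof. by case: lamP => lamM lam_xi; split=> // A B /inS_DJ AD /inS_DJ; apply: lamM. Qed.

Let QJ phi : Q phi -> stabQ p m DJ lam phi.
Proof. by move=> Qphi A /inS_DJ; apply: Qphi. Qed.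

(** Some error on [I] with the syndrome of [e]. The default [0] covers syndromes that no error on
    [I] produces, and keeps the correction supported in [I]. *)
Definition correction (e : V) : V :=
  odflt 0 [pick u | (u \in supported_in F I) && (e - u \in tdual DJ)].

Let c : CC := #|DJ|%:R / #|{: V}|%:R.

Let cardV_neq0 : #|{: V}|%:R != 0 :> CC.
Proof. by rewrite pnatr_eq0 -lt0n; apply/card_gt0P; exists (0 : V). Qed.

Let cardDJ_neq0 : #|DJ|%:R != 0 :> CC.
Proof. by rewrite pnatr_eq0 -lt0n; apply/card_gt0P; exists (0 : V); apply: zmod_closed0. Qed.

Let c_ge0 : 0 <= c. Proof. by rewrite divr_ge0 ?ler0n. Qed.

Let sqrt_c : sqrtC c * (sqrtC c)^* = c.
Proof. by rewrite geC0_conj ?sqrtC_ge0 // -expr2 sqrtCK. Qed.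

(* The operators [E_e PJ E_e^*] run over all [e] in [V], so each syndrome projector of [DJ]
   occurs [#|tdual DJ|] times; the factor [sqrt c] compensates for this. *)
Definition recovery (e : V) : 'M[CC]_N :=
  sqrtC c *: (adj (pauli (correction e)) *m (pauli e *m PJ *m adj (pauli e))).

Let correction_supported e : correction e \in supported_in F I.
Proof.
rewrite /correction; case: pickP => [u /andP[] //|_] /=.
exact: zmod_closed0 (supported_in_zmod _ _).
Qed.

(** Although [e] is arbitrary, conjugating [PJ] by [pauli e] only changes the phases of its terms
    [pauli y], all with [y] supported in [J]. *)
Let recovery_acts_on e : acts_on J (recovery e).
Proof.
have fJ := sub_supported_in IJ (correction_supported e).
have Jz := supported_in_zmod F J.
rewrite /recovery stab_proj_conj // pauli_adj // -scalemxAl -scalemxAr !scalerA mulmx_sumr.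
rewrite scaler_sumr; set a := _ * _.
rewrite (eq_bigr (fun y => a * ((lam (pauli y))^-1 * chi (symp y e) *
    chi (eucl (- correction e).2 y.1)) *: pauli (- correction e + y))) => [|y _]; last first.
  by rewrite -scalemxAr pauliM // !scalerA !mulrA.
apply: acts_on_sum => y /setIP[_ yJ]; apply: pauli_acts_on => //.
by rewrite zmod_closed_add // zmod_closed_opp.
Qed.

Let recovery_complete : \sum_(e : V) adj (recovery e) *m recovery e = 1%:M.
Proof.
rewrite (eq_bigr (fun e => c *: (pauli e *m PJ *m adj (pauli e)))) => [|e _].
  rewrite -scaler_sumr sum_syndrome_proj // scale_scalar_mx.
  by rewrite /c mulrA divfK // divff.
rewrite /recovery adjZ -scalemxAl -scalemxAr scalerA mulrC sqrt_c; congr (_ *: _).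
rewrite !adjM !adjK -!mulmxA pauli_mulKmx // pauli_adjKmx //.
by rewrite [adj PJ *m _]mulmxA stab_proj_adj_mul.
Qed.

Let recovery_error e u phi : u \in supported_in F I -> Q phi ->
  let psi := recovery e *m (pauli u *m phi) in
  psi *m adj psi = (if e - u \in tdual DJ then c else 0) *: (phi *m adj phi).
Proof.
move=> uI Qphi psi; rewrite /psi /recovery -scalemxAl -mulmxA syndrome_proj //; last exact: QJ.
case: ifP => euDJ; last by rewrite mulmx0 scaler0 mul0mx scale0r.
(* The search in [correction e] cannot fail here, as [u] itself qualifies. *)
have [u' [u'I eu'DJ u'E]] : exists u', [/\ u' \in supported_in F I, e - u' \in tdual DJ
    & u' = correction e].
  rewrite /correction; case: pickP => [u' /andP[? ?]|/(_ u)] /=; first by exists u'.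
  by rewrite uI euDJ.
rewrite -u'E; pose w : V := u - u'.
have DJ'z := tdual_zmod p_pr m_gt0 cardF DJ.
have Iz := supported_in_zmod F I.
have wI : w \in supported_in F I by case: Iz => _; apply.
have wDJ : w \in tdual DJ.
  have -> : w = (e - u') - (e - u) by rewrite opprB addrC addrA subrK.
  by case: DJ'z => _; apply.
have wD : w \in D.
  (* [v] agrees with [w] on [J], so it vanishes on [J] outside [I] and its restriction to [I] is
     [w]; hence [local_trivial] applies to it. *)
  clearbody w; have [v vD wvJ] := tdual_capP p_pr m_gt0 cardF Dz wDJ.
  move/supported_inP: wI => wI; move/supported_inP: wvJ => wvJ.
  have wv k : k \in J -> w.1 0 k = v.1 0 k /\ w.2 0 k = v.2 0 k.
    move=> kJ; have [] := wvJ k; first by rewrite inE negbK.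
    by rewrite !mxE => /subr0_eq -> /subr0_eq ->.
  suff -> : w = restr2 I v.
    by apply: IJtriv => // k kJ kI; have [<- <-] := wv k kJ; apply: wI.
  rewrite [LHS]surjective_pairing; congr (_, _); apply/rowP => k; rewrite mxE;
    by case: ifP => [/(subsetP IJ)/wv[]|/negbT/wI[]].
have -> : adj (pauli u') *m (pauli u *m phi) =
    (chi (eucl u'.2 u'.1) * chi (eucl (- u').2 u.1) * lam (pauli w)) *: phi.
  rewrite pauli_adj // -scalemxAl mulmxA pauliM // -scalemxAl [- u' + u]addrC.
  by rewrite ((stabQP p_pr m_gt0 cardF Dz lamP _).1 Qphi) // !scalerA.
(* The phases in [a] have modulus one and cancel in [psi *m adj psi], leaving only [c]. *)
set a := _ * lam _; rewrite scalerA adjZ -scalemxAl -scalemxAr scalerA; congr (_ *: _).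
rewrite conjMC mulrACA sqrt_c; apply: etrans (mulr1 _); congr (_ * _).
rewrite /a !conjMC mulrACA (lam_pauli_norm p_pr m_gt0 cardF Dz lamP wD) mulr1 mulrACA.
by rewrite !(chi_unit p_pr m_gt0 cardF) mulr1.
Qed.

Lemma loc_recoverable_of_trivial : loc_recoverable p m Q I J.
Proof.
exists #|{: V}|, (fun k => recovery (enum_val k)); split => [k|| phi Qphi].
- exact: recovery_acts_on.
- by rewrite (sum_enum_val (fun e => adj (recovery e) *m recovery e)).
rewrite (sum_enum_val (fun e => recovery e *m GammaI p m I (phi *m adj phi) *m adj (recovery e))).
transitivity ((#|supported_in F I|%:R)^-1 *: \sum_(e : V) \sum_(u in supported_in F I)
    (if e - u \in tdual DJ then c else 0) *: (phi *m adj phi)).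
  rewrite scaler_sumr; apply: eq_bigr => e _.
  rewrite GammaIE -scalemxAr -scalemxAl; congr (_ *: _).
  rewrite mulmx_sumr mulmx_suml; apply: eq_bigr => u uI.
  by rewrite -recovery_error // !adjM !mulmxA.
rewrite exchange_big /= (eq_bigr (fun=> phi *m adj phi)) => [|u uI].
  rewrite sumr_const -[X in _ *: X]scaler_nat scalerA mulVf ?scale1r //.
  exact: lt0r_neq0 (card_supported_in_gt0 _).
(* For fixed [u], exactly [#|tdual DJ|] values of [e] contribute [c] each, and [c] is the inverse of
   that number by [card_tdual]. *)
rewrite -scaler_suml (reindex_inj (addIr u)) /= -[RHS]scale1r; congr (_ *: _).
under eq_bigr => e _ do rewrite addrK.
rewrite -big_mkcond sumr_const -[LHS]mulr_natr mulrAC -natrM.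
by rewrite (card_tdual p_pr m_gt0 cardF DJz) divff.
Qed.

End Sufficiency.

Lemma trivial_of_loc_recoverable (I J : {set 'I_n}) : I \subset J ->
  loc_recoverable p m Q I J -> local_trivial I J.
Proof.
move=> IJ [s [Kr [KrJ _ KrQ]]] v vD vJI; set vI := restr2 I v.
have [//|vI_notD] := boolP (vI \in D).
pose P := stab_proj p m D lam.
have Iz := supported_in_zmod F I; have vI_I : vI \in supported_in F I := restr2_supported I v.
pose w : V := v - vI; have wJ : w \in supported_in F (~: J) := supported_in_off vJI.
have comm_w (A : 'M[CC]_N) : acts_on J A -> A *m pauli w = pauli w *m A.
  by move=> AJ; apply: acts_on_comm wJ.
pose psi (phi : 'cV[CC]_N) (ku : 'I_s * V) := Kr ku.1 *m (pauli ku.2 *m phi).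
have psiE phi : Q phi -> (#|supported_in F I|%:R)^-1 *:
    (\sum_(ku | ku.2 \in supported_in F I) psi phi ku *m adj (psi phi ku)) = phi *m adj phi.
  move=> Qphi; rewrite -KrQ // -(pair_big predT (fun u => u \in supported_in F I)
    (fun k u => psi phi (k, u) *m adj (psi phi (k, u)))) scaler_sumr.
  apply: eq_bigr => k _; rewrite GammaIE -scalemxAr -scalemxAl; congr (_ *: _).
  by rewrite mulmx_sumr mulmx_suml; apply: eq_bigr => u uI; rewrite /psi !adjM !mulmxA.
have card_gt0 : 0 < (#|supported_in F I|%:R)^-1 :> CC by rewrite invr_gt0 card_supported_in_gt0.
have psi_line phi k u : Q phi -> u \in supported_in F I ->
    exists a, Kr k *m (pauli u *m phi) = a *: phi.
  by move=> Qphi uI; apply: (rank_one_sum card_gt0 (psiE phi Qphi) (k := (k, u))).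
have eigQ (phi : 'cV_N) : Q phi -> exists a, pauli vI *m phi = a *: phi.
  move=> Qphi; have Qphi' : Q (pauli v *m phi) by apply: stab_tdual.
  set phi' := pauli v *m phi in Qphi'.
  have [phi0|phi_neq0] := eqVneq phi 0; first by exists 0; rewrite phi0 mulmx0 scaler0.
  have phi'_neq0 : phi' != 0.
    apply: contraNneq phi_neq0 => phi'0.
    by rewrite -[phi]mul1mx -(pauli_unitaryl p_pr m_gt0 cardF v) -mulmxA -/phi' phi'0 mulmx0.
  (* The operators [psi phi' ku *m adj (psi phi' ku)] sum, up to a factor, to [phi' *m adj phi'],
     which is nonzero; so some [Kr k *m pauli u] does not kill [phi'], and its eigenvalue [a'] can
     be divided by. *)
  have [[k u] /= uI psi_neq0] : exists2 ku, ku.2 \in supported_in F I & psi phi' ku != 0.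
    apply/exists_inP; apply: contraNT phi'_neq0.
    rewrite negb_exists_in => /forall_inP psi0; rewrite -[phi']adjK.
    suff -> : adj phi' = 0 by rewrite adj0.
    apply: adj_mul_eq0; rewrite adjK -psiE // big1 ?scaler0 // => ku kuI.
    by have /negPn/eqP -> := psi0 ku kuI; rewrite mul0mx.
  have [a' a'E] := psi_line phi' k u Qphi' uI.
  have a'_neq0 : a' != 0.
    by apply: contraNneq psi_neq0 => a'0; rewrite /psi /= a'E a'0 scale0r.
  have [a aE] := psi_line phi k (u + vI) Qphi (zmod_closed_add Iz uI vI_I).
  have uJ := pauli_acts_on p_pr m_gt0 cardF (sub_supported_in IJ uI).
  have wvI : pauli w *m pauli vI = chi (eucl w.2 vI.1) *: pauli v by rewrite pauliM // subrK.
  exists (a'^-1 * (chi (eucl u.2 vI.1) * a)); apply: (scalerI a'_neq0).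
  rewrite scalerA mulVKf //.
  (* Both sides equal [Kr k] applied to [pauli u *m pauli w *m pauli vI *m phi]: merging [w] with
     [vI] gives [phi'] and the factor [a']; moving [pauli w] to the left and merging [u] with [vI]
     gives the factor [a]. *)
  have : pauli w *m (a' *: (pauli vI *m phi)) =
         pauli w *m ((chi (eucl u.2 vI.1) * a) *: phi).
    have phi'E : chi (eucl w.2 vI.1) *: phi' = pauli w *m (pauli vI *m phi).
      by rewrite mulmxA wvI -scalemxAl.
    have -> : pauli w *m (a' *: (pauli vI *m phi)) =
              Kr k *m (pauli u *m (pauli w *m (pauli vI *m phi))).
      by rewrite -phi'E -!scalemxAr a'E -phi'E !scalerA mulrC.
    rewrite [pauli u *m _]mulmxA comm_w // -mulmxA mulmxA comm_w // -mulmxA.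
    by rewrite [pauli u *m _]mulmxA pauliM // -scalemxAl -scalemxAr aE scalerA.
  move/(congr1 (mulmx (adj (pauli w)))).
  by rewrite !mulmxA pauli_unitaryl // !mul1mx.
(* The eigenvalue in [eigQ] may depend on [phi]; [eigen_scalar] makes it uniform over the image of
   [P]. *)
have [a aE] : exists a, pauli vI *m P = a *: P.
  by apply: eigen_scalar => x; apply/eigQ/stab_proj_mem.
have a0 : a = 0.
  apply: (mulIf (mxtrace_stab_proj_neq0 p_pr m_gt0 cardF Dz lamP)).
  by rewrite -mxtraceZ -aE mxtrace_pauli_proj // mul0r.
case/eqP: (stab_proj_neq0 p_pr m_gt0 cardF Dz lamP).
rewrite -/P -[P]mul1mx -(pauli_unitaryl p_pr m_gt0 cardF vI) -mulmxA aE a0.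
by rewrite scale0r mulmx0.
Qed.

End Recovery.

(** * Euclidean and Hermitian codes *)

(* Imported only here, since it replaces the [field] of Stdlib used above. *)
From mathcomp Require Import ring.

Section Codes.
Context (K : finFieldType) (n : nat).
Implicit Types (I J : {set 'I_n}) (C Cd : {set 'rV[K]_n}).

Lemma lincode_zmod C : lincode C -> zmod_closed C.
Proof. by case=> C0 CD; split=> // x y xC yC; rewrite addrC -scaleN1r CD. Qed.

Lemma lincodeZ C c x : lincode C -> x \in C -> c *: x \in C.
Proof. by case=> C0 CD xC; rewrite -[_ *: _]addr0 CD. Qed.

Lemma restr_id I (c : 'rV[K]_n) : supp c \subset I -> restr I c = c.
Proof. by move/supp_subP => cI; apply/rowP => k; rewrite mxE; case: ifP => // /negbT/cI. Qed.

Lemma restr_restr I J (c : 'rV[K]_n) : I \subset J -> restr I (restr J c) = restr I c.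
Proof. by move/subsetP => IJ; apply/rowP => k; rewrite !mxE; case: ifP => // /IJ ->. Qed.

(** Only one inclusion carries content: a word of [C] supported in [I] lies in [Cd] and is its own
    restriction to [J]. *)
Lemma shorten_punctP C Cd I J : C \subset Cd -> I \subset J ->
  Defs.shorten I (punct J Cd) = Defs.shorten I C <->
  (forall c, c \in Cd -> (forall k, k \in J -> k \notin I -> c 0 k = 0) -> restr I c \in C).
Proof.
move=> CCd IJ.
have inC x : x \in C -> supp x \subset I -> x \in Defs.shorten I C.
  by move=> xC xI; apply/imsetP; exists x; rewrite ?inE ?xC // restr_id.
have Cin x : x \in Defs.shorten I C -> x \in C.
  by case/imsetP=> y; rewrite inE => /andP[yC yI] ->; rewrite restr_id.
have inCd c : c \in Cd -> (forall k, k \in J -> k \notin I -> c 0 k = 0) ->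
    restr I c \in Defs.shorten I (punct J Cd).
  move=> cCd cJI; apply/imsetP; exists (restr J c); last by rewrite restr_restr.
  rewrite inE; apply/andP; split; first by apply/imsetP; exists c.
  by apply/supp_subP => k kI; rewrite mxE; case: ifP => // kJ; apply: cJI.
split=> [CdE c cCd cJI | CdC]; first by apply: Cin; rewrite -CdE; apply: inCd.
apply/setP => x; apply/imsetP/idP.
  case=> y; rewrite inE => /andP[/imsetP[c cCd ->] /supp_subP cI] ->.
  rewrite restr_restr //; apply: inC; last first.
    by apply/supp_subP => k /negPf kI; rewrite mxE kI.
  by apply: CdC => // k kJ kI; have := cI k kI; rewrite mxE kJ.
move=> xC; have xI : supp x \subset I.
  case/imsetP: xC => y; rewrite inE => /andP[_ yI] ->.
  by apply/supp_subP => k /negPf kI; rewrite mxE kI.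
exists x; last by rewrite restr_id.
rewrite inE xI andbT; apply/imsetP; exists x; last by rewrite restr_id // (subset_trans xI).
exact: (subsetP CCd) (Cin _ xC).
Qed.

End Codes.

(** * From the stabilizer criterion to linear codes *)

Section Transfer.
Context (p m : nat) (F : finFieldType) (n : nat).
Hypotheses (p_pr : prime p) (m_gt0 : (0 < m)%N) (cardF : #|F| = (p ^ m)%N).
Local Notation chi := (@chi F p m).
Local Notation V := ('rV[F]_n * 'rV[F]_n)%type.

Lemma qLRC_iff (D : {set V}) (lam : 'M[CC]_(dimH F n) -> CC) (K : finFieldType)
    (C Cd : {set 'rV[K]_n}) (r delta : nat) :
    zmod_closed D -> stab_char p m D lam -> C \subset Cd ->
    (forall I J : {set 'I_n}, I \subset J -> local_trivial p m D I J <->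
      forall c, c \in Cd -> (forall k, k \in J -> k \notin I -> c 0 k = 0) -> restr I c \in C) ->
  qLRC p m (stabQ p m D lam) r delta <-> LRC_cond C Cd r delta.
Proof.
move=> Dz lamP CCd DC.
have locE (I J : {set 'I_n}) : I \proper J ->
    loc_recoverable p m (stabQ p m D lam) I J <-> Defs.shorten I (punct J Cd) = Defs.shorten I C.
  move=> /proper_sub IJ; split=> [rec | /(shorten_punctP CCd IJ)/(DC I J IJ) triv].
    apply/(shorten_punctP CCd IJ)/(DC I J IJ).
    exact: (trivial_of_loc_recoverable p_pr m_gt0 cardF Dz lamP IJ rec).
  exact: loc_recoverable_of_trivial.
split=> H i; have [J [iJ cardJ HJ]] := H i; exists J; split=> // I IJ cardI;
  by apply/locE => //; apply: HJ.
Qed.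

(** Scaling [u] by every [x] in [F] turns the condition on [chi] into vanishing of the form itself,
    by [chi_nontrivial]. *)
Lemma tdual_lincode_symp (D : {set V}) v :
    (forall x u, u \in D -> (x *: u.1, x *: u.2) \in D) ->
  v \in tdual p m D -> forall u, u \in D -> symp u v = 0.
Proof.
move=> DZ /tdualP vD u uD; apply: (chi_nontrivial p_pr m_gt0 cardF) => x.
by rewrite -(vD _ (DZ x u uD)) /symp /= !euclZl mulrBr.
Qed.

Lemma tdual_Deucl (C : {set 'rV[F]_n}) : lincode C ->
  tdual p m (Deucl C) = setX (edual C) (edual C).
Proof.
move=> Clin; have C0 := zmod_closed0 (lincode_zmod Clin).
have edualP (a : 'rV[F]_n) : reflect (forall x, x \in C -> eucl x a = 0) (a \in edual C).
  rewrite inE; apply: (iffP forall_inP) => aC x xC; first exact/eqP/aC.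
  by rewrite aC.
apply/setP => -[a b]; apply/idP/setXP => [/tdual_lincode_symp vD | [/edualP aC /edualP bC]].
  have DZ x u : u \in Deucl C -> (x *: u.1, x *: u.2) \in Deucl C.
    by case: u => c d /setXP[cC dC]; apply/setXP; split; apply: lincodeZ.
  split; apply/edualP => x xC.
    have := vD DZ (0, x); rewrite /symp /= eucl0l sub0r => /(_ _)/eqP.
    by rewrite oppr_eq0 => /(_ _)/eqP; apply; apply/setXP.
  have := vD DZ (x, 0); rewrite /symp /= eucl0l subr0; apply.
  by apply/setXP.
apply/tdualP => -[c d] /setXP[cC dC].
by rewrite /symp /= aC // bC // subrr chi0.
Qed.

Lemma Deucl_local_trivial (C : {set 'rV[F]_n}) (I J : {set 'I_n}) : lincode C ->
  local_trivial p m (Deucl C) I J <->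
  forall c, c \in edual C -> (forall k, k \in J -> k \notin I -> c 0 k = 0) -> restr I c \in C.
Proof.
move=> Clin; rewrite /local_trivial tdual_Deucl //; split=> [triv c cC cJI | triv [a b]].
  have Cd0 : 0 \in edual C.
    rewrite inE; apply/forall_inP => x _; apply/eqP/big1 => k _.
    by rewrite mxE mulr0.
  have /setXP[] // : restr2 I (c, 0) \in Deucl C.
  by apply: triv; [apply/setXP | move=> k kJ kI; rewrite /= mxE cJI].
move=> /setXP[/= aC bC] abJI; apply/setXP; split; apply: triv => // k kJ kI;
  by have [] := abJI k kJ kI.
Qed.

(** * Hermitian codes through a normal basis *)

Section Hermitian.
Context (K : finFieldType) (iota : {rmorphism F -> K}) (vs : K).
Hypotheses (cardK : #|K| = ((p ^ m) ^ 2)%N) (vs_nb : normal_basis iota (p ^ m) vs).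
Local Notation q := (p ^ m)%N.
Local Notation psi := (@psi F K iota q vs n).

Let exprqD (x y : K) : (x + y) ^+ q = x ^+ q + y ^+ q.
Proof.
have pchar_K : p \in [pchar K] by apply: (@card_finPcharP _ _ (m * 2)); rewrite ?expnM.
have q_nat : [pchar K].-nat q by rewrite pnatX pnatE // pchar_K.
by rewrite exprDn_pchar.
Qed.

Let expr_sumq (f : 'I_n -> K) : (\sum_k f k) ^+ q = \sum_k f k ^+ q.
Proof.
apply: (big_morph (fun x : K => x ^+ q) exprqD).
by rewrite expr0n expn_eq0 -leqn0 leqNgt prime_gt0.
Qed.

Let iotaq a : iota a ^+ q = iota a.
Proof. by rewrite -rmorphXn -cardF expf_card. Qed.

Let vsqq : (vs ^+ q) ^+ q = vs.
Proof. by rewrite -exprM mulnn -cardK expf_card. Qed.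

Let psiE (v : V) k : psi v 0 k = vs * iota (v.1 0 k) + vs ^+ q * iota (v.2 0 k).
Proof. by rewrite !mxE. Qed.

Let psiqE (v : V) k : psi v 0 k ^+ q = vs ^+ q * iota (v.1 0 k) + vs * iota (v.2 0 k).
Proof. by rewrite psiE exprqD !exprMn !iotaq vsqq. Qed.

(** This and [vs_neqN] make both factors of [vs ^+ 2 - (vs ^+ q) ^+ 2], the constant in [herm_symp],
    nonzero. *)
Let vs_neq : vs != vs ^+ q.
Proof.
apply/eqP => vsE; have [|/eqP] := vs_nb.1 1 (-1); last by rewrite oner_eq0.
by rewrite rmorphN rmorph1 mul1r mulN1r -vsE subrr.
Qed.

Let vs_neqN : vs + vs ^+ q != 0.
Proof.
apply/eqP => vsE; have [|/eqP] := vs_nb.1 1 1; last by rewrite oner_eq0.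
by rewrite rmorph1 !mul1r.
Qed.

(** The [q]-th power swaps [vs] and [vs ^+ q] and fixes the image of [iota]. The terms in
    [vs * vs ^+ q] cancel, and the remaining ones are antisymmetric. *)
Lemma herm_symp (u v : V) :
  herm q (psi u) (psi v) - herm q (psi u) (psi v) ^+ q =
  (vs ^+ 2 - (vs ^+ q) ^+ 2) * iota (symp u v).
Proof.
rewrite /herm expr_sumq -sumrB /symp /eucl -sumrB rmorph_sum mulr_sumr.
apply: eq_bigr => k _; rewrite exprMn !psiqE exprqD !exprMn vsqq !iotaq psiE.
by rewrite rmorphB !rmorphM /=; ring.
Qed.

Lemma psi_eq0 (v : V) k : psi v 0 k = 0 <-> v.1 0 k = 0 /\ v.2 0 k = 0.
Proof.
rewrite psiE; split=> [v0|[-> ->]]; last by rewrite rmorph0 !mulr0 addr0.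
by apply: vs_nb.1; rewrite ![iota _ * _]mulrC.
Qed.

Lemma psi_surj (x : 'rV[K]_n) : exists v : V, psi v = x.
Proof.
have [f fE] : exists f : 'I_n -> F * F, forall k,
    x 0 k = iota (f k).1 * vs + iota (f k).2 * vs ^+ q.
  apply: (@fin_all_exists _ (fun=> (F * F)%type) (fun k ab =>
    x 0 k = iota ab.1 * vs + iota ab.2 * vs ^+ q)) => k.
  by have [a [b abE]] := vs_nb.2 (x 0 k); exists (a, b).
exists (\row_k (f k).1, \row_k (f k).2); apply/rowP => k.
by rewrite psiE !mxE fE ![iota _ * _]mulrC.
Qed.

Lemma psi_restr2 I (v : V) : psi (restr2 I v) = restr I (psi v).
Proof.
apply/rowP => k; rewrite psiE [RHS]mxE psiE !mxE; case: ifP => // _.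
by rewrite rmorph0 !mulr0 addr0.
Qed.

Lemma psiZ x (v : V) : psi (x *: v.1, x *: v.2) = iota x *: psi v.
Proof. by apply/rowP => k; rewrite psiE [RHS]mxE psiE !mxE !rmorphM; ring. Qed.

Lemma psiB (u v : V) : psi (u - v) = psi u - psi v.
Proof. by apply/rowP => k; rewrite psiE [RHS]mxE [X in _ = _ + X]mxE !psiE !mxE !rmorphB; ring. Qed.

Lemma hermZl c (x y : 'rV[K]_n) : herm q (c *: x) y = c * herm q x y.
Proof. by rewrite /herm mulr_sumr; apply: eq_bigr => k _; rewrite mxE mulrA. Qed.

Lemma Dherm_zmod (C : {set 'rV[K]_n}) : lincode C -> zmod_closed (Dherm iota q vs C).
Proof.
move=> /lincode_zmod[C0 CB]; split=> [|u v]; last by rewrite !inE psiB; apply: CB.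
rewrite inE (_ : psi 0 = 0) //; apply/rowP => k.
by rewrite psiE !mxE rmorph0 !mulr0 addr0.
Qed.

(* If [h = herm x (psi v)] were nonzero for some [x] in [C], then [h = h ^+ q] and
   [vs * h = (vs * h) ^+ q] would both hold, forcing [vs = vs ^+ q]. *)
Lemma tdual_Dherm (C : {set 'rV[K]_n}) (v : V) : lincode C ->
  (v \in tdual p m (Dherm iota q vs C)) = (psi v \in hdual q C).
Proof.
move=> Clin; apply/idP/idP => [/tdual_lincode_symp vD | vC].
  have DZ x u : u \in Dherm iota q vs C -> (x *: u.1, x *: u.2) \in Dherm iota q vs C.
    by rewrite !inE psiZ; apply: lincodeZ.
  have herm_fixed x : x \in C -> herm q x (psi v) ^+ q = herm q x (psi v).
    have [u <-] := psi_surj x => uC; apply/esym/eqP; rewrite -subr_eq0 herm_symp.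
    by rewrite vD ?inE // rmorph0 mulr0.
  rewrite inE; apply/forall_inP => x xC; apply/negPn/negP => h_neq0.
  have := herm_fixed _ (lincodeZ vs Clin xC).
  rewrite hermZl exprMn (herm_fixed x xC) => /(mulIf h_neq0) vsE.
  by have := vs_neq; rewrite vsE eqxx.
apply/tdualP => u; rewrite inE => uC; move: vC; rewrite inE => /forall_inP/(_ _ uC)/eqP h0.
suff -> : symp u v = 0 by rewrite chi0.
have /esym/eqP := herm_symp u v.
rewrite h0 expr0n expn_eq0 -leqn0 leqNgt prime_gt0 // subrr mulf_eq0 fmorph_eq0.
by rewrite subr_sqr mulf_eq0 subr_eq0 (negPf vs_neq) (negPf vs_neqN) => /eqP.
Qed.

Lemma Dherm_local_trivial (C : {set 'rV[K]_n}) (I J : {set 'I_n}) : lincode C ->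
  local_trivial p m (Dherm iota q vs C) I J <->
  forall c, c \in hdual q C -> (forall k, k \in J -> k \notin I -> c 0 k = 0) -> restr I c \in C.
Proof.
move=> Clin; split=> [triv c | triv v].
  have [v <-] := psi_surj c; rewrite -tdual_Dherm // => vD vJI.
  have := triv v vD; rewrite inE psi_restr2; apply => k kJ kI.
  by apply/psi_eq0/vJI.
rewrite tdual_Dherm // => vD vJI; rewrite inE psi_restr2; apply: triv => // k kJ kI.
by apply/psi_eq0/vJI.
Qed.

End Hermitian.

End Transfer.

Theorem theorem26 :
  (* Hermitian case: F = F_q, K = F_{q^2}, q = p^m *)
  (forall (p m : nat) (F K : finFieldType) (iota : {rmorphism F -> K}) (vs : K)
          (n r delta : nat) (C : {set 'rV[K]_n}) (lam : 'M[CC]_(dimH F n) -> CC),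
      prime p -> (0 < m)%N -> #|F| = (p ^ m)%N -> #|K| = ((p ^ m) ^ 2)%N ->
      normal_basis iota (p ^ m) vs ->
      (1 <= r)%N -> (2 <= delta)%N ->
      lincode C -> C \subset hdual (p ^ m) C ->
      stab_char p m (Dherm iota (p ^ m) vs C) lam ->
      (qLRC p m (stabQ p m (Dherm iota (p ^ m) vs C) lam) r delta <->
       LRC_cond C (hdual (p ^ m) C) r delta))
  /\
  (* Euclidean case: F = F_q, q = p^m *)
  (forall (p m : nat) (F : finFieldType)
          (n r delta : nat) (C : {set 'rV[F]_n}) (lam : 'M[CC]_(dimH F n) -> CC),
      prime p -> (0 < m)%N -> #|F| = (p ^ m)%N ->
      (1 <= r)%N -> (2 <= delta)%N ->
      lincode C -> C \subset edual C ->
      stab_char p m (Deucl C) lam ->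
      (qLRC p m (stabQ p m (Deucl C) lam) r delta <->
       LRC_cond C (edual C) r delta)).
Proof.
split=> [p m F K iota vs n r delta C lam p_pr m_gt0 cardF cardK vs_nb _ _ Clin CCd lamP |
         p m F n r delta C lam p_pr m_gt0 cardF _ _ Clin CCd lamP].
  apply: qLRC_iff => //; first exact: Dherm_zmod.
  by move=> I J _; apply: Dherm_local_trivial.
apply: qLRC_iff => //; last by move=> I J _; apply: Deucl_local_trivial.
have [C0 CB] := lincode_zmod Clin.
split=> [|[a b] [c d] /setXP[aC bC] /setXP[cC dC]]; apply/setXP; first by [].
by split; apply: CB.
Qed.
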